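(* Let $A$ be a $Dup$-$Dend$ bialgebra. Assume that $A$ is graded and connected, that is to say $A_0=(0)$. Let $(p_d)_{d\in\mathcal{D}}$ be a basis of $Prim_{tot}(A)$ formed by homogeneous elements, indexed by a graded set $\mathcal{D}$ (so that $d\in \mathcal{D}(n)$ when $p_d$ is of degree $n$). There exists a unique isomorphism of graded $Dup$-$Dend$ bialgebras $$\phi:(\mathbf{H}_p^{\mathcal{D}})_+\longrightarrow A$$ sending $\bullet_d$ to $p_d$ for all $d\in\mathcal{D}$.
   Context: $K$ is a commutative field; all vector spaces are over $K$. **$Dup$-$Dend$ bialgebras.** A duplicial algebra is a vector space $A$ with two bilinear products $.$ (written $xy$) and $\nwarrow$ such that for all $x,y,z\in A$: $(xy)z=x(yz)$, $(x\nwarrow y)\nwarrow z=x\nwarrow(y\nwarrow z)$, $(xy)\nwarrow z=x(y\nwarrow z)$. A dendriform coalgebra is a vector space $A$ with two maps $\tilde\Delta_\prec,\tilde\Delta_\succ:A\to A\otimes A$ such that, with $\tilde\Delta=\tilde\Delta_\prec+\tilde\Delta_\succ$: $$(\tilde\Delta_\prec\otimes Id)\tilde\Delta_\prec=(Id\otimes\tilde\Delta)\tilde\Delta_\prec,\quad (\tilde\Delta_\succ\otimes Id)\tilde\Delta_\prec=(Id\otimes\tilde\Delta_\prec)\tilde\Delta_\succ,\quad (\tilde\Delta\otimes Id)\tilde\Delta_\succ=(Id\otimes\tilde\Delta_\succ)\tilde\Delta_\succ.$$ Sweedler notation: $\tilde\Delta(a)=a'\otimes a''$, $\tilde\Delta_\prec(a)=a'_\prec\otimes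 a''_\prec$, $\tilde\Delta_\succ(a)=a'_\succ\otimes a''_\succ$. $Prim_{tot}(A)=Ker(\tilde\Delta_\prec)\cap Ker(\tilde\Delta_\succ)$. A $Dup$-$Dend$ bialgebra is a family $(A,.,\nwarrow,\tilde\Delta_\prec,\tilde\Delta_\succ)$ such that $(A,.,\nwarrow)$ is a duplicial algebra, $(A,\tilde\Delta_\prec,\tilde\Delta_\succ)$ is a dendriform coalgebra, and for all $x,y\in A$: $$\tilde\Delta_\prec(xy)=y\otimes x+x'y\otimes x''+xy'_\prec\otimes y''_\prec+y'_\prec\otimes xy''_\prec+x'y'_\prec\otimes x''y''_\prec,$$ $$\tilde\Delta_\succ(xy)=x\otimes y+x'\otimes x''y+xy'_\succ\otimes y''_\succ+y'_\succ\otimes xy''_\succ+x'y'_\succ\otimes x''y''_\succ,$$ $$\tilde\Delta_\prec(x\nwarrow y)=y\otimes x+y'_\prec\otimes x\nwarrow y''_\prec+x'_\prec\nwarrow y\otimes x''_\prec+x'_\succ y\otimes x''_\succ+x'_\succ y'_\prec\otimes x''_\succ\nwarrow y''_\prec,$$ $$\tilde\Delta_\succ(x\nwarrow y)=y'_\succ\otimes x\nwarrow y''_\succ+x'_\succ\otimes x''_\succ\nwarrow y+x'_\succ y'_\succ\otimes x''_\succ\nwarrow y''_\succ.$$ It is graded if $A=\bigoplus_{n\ge0}A_n$ and all four structure maps are homogeneous of degree $0$. Morphisms of graded $Dup$-$Dend$ bialgebras are linear maps, homogeneous of degree $0$, compatible with $.$, $\nwarrow$, $\tilde\Delta_\prec$,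 $\tilde\Delta_\succ$. **$(\mathbf{H}_p^{\mathcal{D}})_+$.** A rooted forest is a finite graph whose connected components are rooted trees; edges are oriented from leaves to roots, $w\to v$ means there is an edge from $w$ to $v$, and $v\twoheadrightarrow w$ means there is an oriented path from $v$ to $w$ (with $v\twoheadrightarrow v$). A planar forest is a rooted forest with a total order (from left to right) on its roots and, for each vertex $v$, on $\{w:w\to v\}$. A planar forest decorated by $\mathcal{D}$ is a planar forest $F$ with a map from its vertex set $V(F)$ to $\mathcal{D}$. $(\mathbf{H}_p^{\mathcal{D}})_+$ has basis the non-empty planar forests decorated by $\mathcal{D}$; $\bullet_d$ denotes the one-vertex tree decorated by $d$; the degree of a forest is the sum of the degrees of its decorations. The product $FG$ is concatenation; $F\nwarrow G$ is obtained by grafting $G$ on the rightmost leaf of $F$. A subset $\boldsymbol v\subseteq V(F)$ is an admissible cut if there are no two distinct $v,w\in\boldsymbol v$ with $v\twoheadrightarrow w$; $Lea_{\boldsymbol v}F$ is the sub-forest on $\{w:\exists v\in\boldsymbol v,\ w\twoheadrightarrow v\}$ and $Roo_{\boldsymbol v}F$ the sub-forest on the other vertices. With $r_F$ the rightmost leaf of $F$, $\tilde\Delta_\prec(F)$ (resp. $\tilde\Delta_\succ(F)$) is the sum of $Lea_{\boldsymbol v}F\otimes Roo_{\boldsymbol v}F$ over the admissible cuts $\boldsymbol v$ with $Lea_{\boldsymbol v}F$ and $Roo_{\boldsymbol v}F$ both non-empty and $r_F\in Lea_{\boldsymbol v}F$ (resp. $r_F\in Roo_{\boldsymbol v}F$).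 With these operations $(\mathbf{H}_p^{\mathcal{D}})_+$ is a $Dup$-$Dend$ bialgebra.
   Formalization: In the compatibility formula for Δ̃_≻(x↖y), the printed legs y''_≺ (paired with y'_≻, hence undefined in Sweedler notation) are read as y''_≻, so that both legs come from Δ̃_≻(y). *)

(* Defs.v *)
From HB Require Import structures.
From mathcomp Require Import all_boot all_order all_algebra.
From mathcomp Require Import finmap generic_quotient ring_quotient.
From mathcomp.classical Require Import boolp.
From mathcomp.multinomials Require Import monalg.

Set Implicit Arguments.
Unset Strict Implicit.
Unset Printing Implicit Defensive.

Import GRing.Theory.
Local Open Scope ring_scope.
Local Open Scope quotient_scope.

(* Linear extension to the free module {malg K[I]} of a map defined on its
   basis << i >>, i : I. *)
Definition linext (K : fieldType) (I : choiceType) (V : lmodType K)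
    (f : I -> V) (u : {malg K[I]}) : V :=
  \sum_(i <- msupp u) u@_i *: f i.

Section LinextTheory.
Variables (K : fieldType) (I : choiceType) (V : lmodType K) (f : I -> V).

Lemma linextEw (S : {fset I}) u : (msupp u `<=` S)%fset ->
  linext f u = \sum_(i <- S) u@_i *: f i.
Proof.
move=> le_uS; rewrite /linext (big_fset_incl _ le_uS) //=.
by move=> i _ /mcoeff_outdom ->; rewrite scale0r.
Qed.

Lemma linext_is_linear : linear (linext f).
Proof.
move=> c u v; set S := (msupp u `|` msupp v)%fset.
have le_u : (msupp u `<=` S)%fset by apply: fsubsetUl.
have le_v : (msupp v `<=` S)%fset by apply: fsubsetUr.
have le_uv : (msupp (c *: u + v) `<=` S)%fset.
  apply: fsubset_trans (msuppD_le _ _) _.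
  by rewrite fsubUset le_v (fsubset_trans (msuppZ_le _ _) le_u).
rewrite (linextEw le_u) (linextEw le_v) (linextEw le_uv) scaler_sumr -big_split.
by apply: eq_bigr => i _ /=; rewrite mcoeffD mcoeffZ scalerDl scalerA.
Qed.

HB.instance Definition _ :=
  GRing.isLinear.Build K {malg K[I]} V *:%R (linext f) linext_is_linear.

Lemma linextU c i : linext f << c *g i >> = c *: f i.
Proof. by rewrite (linextEw msuppU_le) big_seq_fset1 mcoeffUU. Qed.

End LinextTheory.

(* The tensor product of two vector spaces of arbitrary dimension: the free
   vector space on A * B modulo the span of the bilinearity relations. *)
Section TensorProduct.
Variables (K : fieldType) (A B : lmodType K).

Local Notation free := {malg K[(A * B)%type]}.

Inductive bilin_span : free -> Prop :=
| BilinSpan0 : bilin_span 0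
| BilinSpanD u v : bilin_span u -> bilin_span v -> bilin_span (u + v)
| BilinSpanZ c u : bilin_span u -> bilin_span (c *: u)
| BilinSpanL c a a' b :
    bilin_span (<< (c *: a + a', b) >> - c *: << (a, b) >> - << (a', b) >>)
| BilinSpanR c a b b' :
    bilin_span (<< (a, c *: b + b') >> - c *: << (a, b) >> - << (a, b') >>).

Definition bilin_rels : free -> bool := fun u => `[< bilin_span u >].

Lemma bilin_rels_zmod_closed : zmod_closed bilin_rels.
Proof.
split=> [|u v /asboolP su /asboolP sv]; apply/asboolP; first exact: BilinSpan0.
by rewrite -scaleN1r; apply: BilinSpanD su (BilinSpanZ _ sv).
Qed.

HB.instance Definition _ :=
  GRing.isZmodClosed.Build free bilin_rels bilin_rels_zmod_closed.

Definition tens : Type :=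
  Quotient.quot (GRing.ZmodClosed.clone free bilin_rels _).
HB.instance Definition _ := GRing.Zmodule.on tens.
HB.instance Definition _ := EqQuotient.on tens.

Definition tscale (c : K) (t : tens) : tens := \pi_tens (c *: repr t).

Lemma pi_tens_eq (u v : free) :
  bilin_span (u - v) -> \pi_tens u = \pi_tens v.
Proof. by move=> suv; apply/eqP; rewrite -Quotient.idealrBE; apply/asboolP. Qed.

Lemma tens_eq_pi (u v : free) :
  \pi_tens u = \pi_tens v -> bilin_span (u - v).
Proof. by move/eqP; rewrite -Quotient.idealrBE => /asboolP. Qed.

Lemma piD_tens (u v : free) : \pi_tens (u + v) = \pi_tens u + \pi_tens v.
Proof. by rewrite !piE. Qed.

Lemma piZ_tens c (u : free) : \pi_tens (c *: u) = tscale c (\pi_tens u).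
Proof.
apply: pi_tens_eq; rewrite -scalerBr; apply: BilinSpanZ.
by apply: tens_eq_pi; rewrite reprK.
Qed.

Fact tscaleA c d t : tscale c (tscale d t) = tscale (c * d) t.
Proof.
rewrite -[t]reprK; move: (repr t) => u.
by rewrite -(piZ_tens d u) -(piZ_tens c (d *: u)) -(piZ_tens _ u) scalerA.
Qed.

Fact tscale1 : left_id 1 tscale.
Proof.
move=> t; rewrite -[t]reprK; move: (repr t) => u.
by rewrite -(piZ_tens _ u) scale1r.
Qed.

Fact tscaleDr : right_distributive tscale +%R.
Proof.
move=> c s t; rewrite -[s]reprK -[t]reprK.
move: (repr s) (repr t) => u v; rewrite -(piD_tens u v) -(piZ_tens c u).
rewrite -(piZ_tens c v) -(piZ_tens c (u + v)) -(piD_tens (c *: u)).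
by rewrite scalerDr.
Qed.

Fact tscaleDl t : {morph tscale^~ t : c d / c + d}.
Proof.
move=> c d /=; rewrite -[t]reprK; move: (repr t) => u.
rewrite -(piZ_tens c u) -(piZ_tens d u) -(piZ_tens (c + d) u).
by rewrite -(piD_tens (c *: u)) scalerDl.
Qed.

HB.instance Definition _ := GRing.Zmodule_isLmodule.Build K tens
  tscaleA tscale1 tscaleDr tscaleDl.

Lemma pi_tens_is_linear : linear (\pi_tens : free -> tens).
Proof. by move=> c u v; rewrite (piD_tens (c *: u)) (piZ_tens c u). Qed.

Definition tpure (a : A) (b : B) : tens := \pi_tens << (a, b) >>.

(* tlift f is the map A (x) B -> V induced by f : A -> B -> V. It is only
   meaningful for a bilinear f, for which tlift_tpure and tlift_is_linear
   below characterize it (the choice of representative is then irrelevant). *)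
Definition tlift (V : lmodType K) (f : A -> B -> V) (t : tens) : V :=
  linext (fun ab : A * B => f ab.1 ab.2) (repr t).

End TensorProduct.

Notation "a \ox b" := (tpure a b)
  (at level 40, left associativity) : ring_scope.

(* Sweedler notation: the value of E on t = a \ox b, extended to all tensors t
   by bilinearity of E in (a, b). *)
Notation "\sw_ ( a , b <- t ) E" := (tlift (fun a b => E) t)
  (at level 41, a name, b name, t at level 50, E at level 41,
   format "'[' \sw_ ( a ,  b  <-  t ) '/  '  E ']'") : ring_scope.

Definition bilinear_map (K : fieldType) (A B C : lmodType K)
    (f : A -> B -> C) : Prop :=
  bilinear_for *:%R *:%R f.

Section TensorTheory.
Variables (K : fieldType) (A B V : lmodType K).

Lemma tpure_bilinear : bilinear_map (@tpure K A B).
Proof.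
split=> [b|a] c x y; rewrite /= /tpure -pi_tens_is_linear; apply: pi_tens_eq.
  by rewrite opprD addrA; apply: BilinSpanL.
by rewrite opprD addrA; apply: BilinSpanR.
Qed.

Lemma tens_span (t : tens A B) :
  exists s : seq (A * B), t = \sum_(p <- s) p.1 \ox p.2.
Proof.
pose pi := (fun u : {malg K[(A * B)%type]} => \pi_(tens A B) u).
have pi_lin : linear pi by exact: pi_tens_is_linear.
pose pil := HB.pack_for {linear _ -> _} pi (GRing.isLinear.Build K _ _ *:%R pi pi_lin).
exists [seq ((repr t)@_p *: p.1, p.2) | p <- msupp (repr t)].
rewrite big_map -[LHS]reprK -[LHS]/(pil (repr t)) {1}[repr t]monalgE linear_sum.
apply: eq_bigr => -[a b] _; set c := _@_ _.
have := (tpure_bilinear.1 b) c a 0; rewrite /= addr0 => ->.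
have := (tpure_bilinear.1 b) 1 0 0; rewrite /= !scale1r addr0.
move/(congr1 (fun z => z - 0 \ox b)); rewrite addrK subrr => <-; rewrite addr0.
rewrite -[c *: _](linearZ_LR pil); congr (pil _); apply/malgP=> k.
by rewrite mcoeffZ !mcoeffU; case: eqP; rewrite ?mulr1 ?mulr0.
Qed.

Variables (f : A -> B -> V) (f_bilin : bilinear_map f).

Let F := linext (fun ab : A * B => f ab.1 ab.2).

Lemma linext_bilin_span u : bilin_span u -> F u = 0.
Proof.
elim=> [|{}u v _ Fu _ Fv|c {}u _ Fu|c a a' b|c a b b'].
- exact: linear0.
- by rewrite /F linearD /= -/F Fu Fv addr0.
- by rewrite /F linearZ /= -/F Fu scaler0.
- rewrite /F !linearB /= linearZ /= !linextU !scale1r /=.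
  by have /= -> := f_bilin.1 b c a a'; rewrite addrAC addrK subrr.
- rewrite /F !linearB /= linearZ /= !linextU !scale1r /=.
  by have /= -> := f_bilin.2 a c b b'; rewrite addrAC addrK subrr.
Qed.

Lemma tlift_pi u : tlift f (\pi_(tens A B) u) = F u.
Proof.
apply/eqP; rewrite -subr_eq0 -[tlift _ _]/(F _) /F -linearB /= -/F.
by apply/eqP/linext_bilin_span/tens_eq_pi; rewrite reprK.
Qed.

Lemma tlift_tpure a b : tlift f (a \ox b) = f a b.
Proof. by rewrite tlift_pi /F linextU scale1r. Qed.

Lemma tlift_is_linear : linear (tlift f).
Proof.
move=> c s t; rewrite -[s]reprK -[t]reprK; move: (repr s) (repr t) => u v.
by rewrite -(pi_tens_is_linear c u v) !tlift_pi /F linearP.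
Qed.

End TensorTheory.

Definition tmap (K : fieldType) (A B A' B' : lmodType K)
    (f : A -> A') (g : B -> B') (t : tens A B) : tens A' B' :=
  \sw_(a, b <- t) f a \ox g b.

Definition tassoc (K : fieldType) (A B C : lmodType K)
    (t : tens (tens A B) C) : tens A (tens B C) :=
  \sw_(u, c <- t) \sw_(a, b <- u) a \ox (b \ox c).

Definition subspace (K : fieldType) (A : lmodType K) (P : A -> Prop) : Prop :=
  P 0 /\ forall (c : K) x y, P x -> P y -> P (c *: x + y).

Definition is_basis (K : fieldType) (A : lmodType K) (P : A -> Prop)
    (I : choiceType) (p : I -> A) : Prop :=
  [/\ forall i, P (p i),
      forall x, P x ->
        exists (s : seq I) (c : I -> K), x = \sum_(i <- s) c i *: p i
    & forall (s : seq I) (c : I -> K), uniq s ->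
        \sum_(i <- s) c i *: p i = 0 -> forall i, i \in s -> c i = 0].

Record dupdend_ops (K : fieldType) (A : lmodType K) := DupDendOps {
  dot : A -> A -> A;
  nwarrow : A -> A -> A;
  cop_prec : A -> tens A A;
  cop_succ : A -> tens A A
}.

Section DupDend.
Variables (K : fieldType) (A : lmodType K) (H : dupdend_ops A).

Local Notation "x ** y" := (dot H x y) (at level 40, left associativity).
Local Notation "x \nw y" := (nwarrow H x y) (at level 40, left associativity).
Local Notation Dprec := (cop_prec H).
Local Notation Dsucc := (cop_succ H).

Definition cop (x : A) : tens A A := Dprec x + Dsucc x.

Record is_duplicial : Prop := IsDuplicial {
  dot_bilinear : bilinear_map (dot H);
  nwarrow_bilinear : bilinear_map (nwarrow H);
  dotA : forall x y z, (x ** y) ** z = x ** (y ** z);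
  nwarrowA : forall x y z, (x \nw y) \nw z = x \nw (y \nw z);
  dot_nwarrowA : forall x y z, (x ** y) \nw z = x ** (y \nw z)
}.

Record is_dendriform_coalg : Prop := IsDendriformCoalg {
  cop_prec_linear : linear Dprec;
  cop_succ_linear : linear Dsucc;
  coprec_coprec : forall x,
    tassoc (tmap Dprec id (Dprec x)) = tmap id cop (Dprec x);
  cosucc_coprec : forall x,
    tassoc (tmap Dsucc id (Dprec x)) = tmap id Dprec (Dsucc x);
  cop_cosucc : forall x,
    tassoc (tmap cop id (Dsucc x)) = tmap id Dsucc (Dsucc x)
}.

Record is_dupdend : Prop := IsDupDend {
  dupdend_dup : is_duplicial;
  dupdend_dend : is_dendriform_coalg;
  cop_prec_dot : forall x y, Dprec (x ** y) =
      y \ox x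
    + \sw_(x1, x2 <- cop x) (x1 ** y) \ox x2
    + \sw_(y1, y2 <- Dprec y) (x ** y1) \ox y2
    + \sw_(y1, y2 <- Dprec y) y1 \ox (x ** y2)
    + \sw_(x1, x2 <- cop x) \sw_(y1, y2 <- Dprec y)
        (x1 ** y1) \ox (x2 ** y2);
  cop_succ_dot : forall x y, Dsucc (x ** y) =
      x \ox y
    + \sw_(x1, x2 <- cop x) x1 \ox (x2 ** y)
    + \sw_(y1, y2 <- Dsucc y) (x ** y1) \ox y2
    + \sw_(y1, y2 <- Dsucc y) y1 \ox (x ** y2)
    + \sw_(x1, x2 <- cop x) \sw_(y1, y2 <- Dsucc y)
        (x1 ** y1) \ox (x2 ** y2);
  cop_prec_nwarrow : forall x y, Dprec (x \nw y) =
      y \ox x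
    + \sw_(y1, y2 <- Dprec y) y1 \ox (x \nw y2)
    + \sw_(x1, x2 <- Dprec x) (x1 \nw y) \ox x2
    + \sw_(x1, x2 <- Dsucc x) (x1 ** y) \ox x2
    + \sw_(x1, x2 <- Dsucc x) \sw_(y1, y2 <- Dprec y)
        (x1 ** y1) \ox (x2 \nw y2);
  cop_succ_nwarrow : forall x y, Dsucc (x \nw y) =
      \sw_(y1, y2 <- Dsucc y) y1 \ox (x \nw y2)
    + \sw_(x1, x2 <- Dsucc x) x1 \ox (x2 \nw y)
    + \sw_(x1, x2 <- Dsucc x) \sw_(y1, y2 <- Dsucc y)
        (x1 ** y1) \ox (x2 \nw y2)
}.

Definition prim_tot (x : A) : Prop := Dprec x = 0 /\ Dsucc x = 0.

Record is_grading (G : nat -> A -> Prop) : Prop := IsGrading {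
  gr_subspace : forall n, subspace (G n);
  gr_sum : forall x, exists (N : nat) (c : nat -> A),
    (forall n, G n (c n)) /\ x = \sum_(n < N) c n;
  gr_direct : forall (N : nat) (c : nat -> A), (forall n, G n (c n)) ->
    \sum_(n < N) c n = 0 -> forall n, (n < N)%N -> c n = 0
}.

(* The component of degree n of A (x) A: the sum over i + j = n of the
   subspaces G i (x) G j. *)
Definition tens_degree (G : nat -> A -> Prop) (n : nat) (t : tens A A) : Prop :=
  exists2 s : seq (A * A), t = \sum_(p <- s) p.1 \ox p.2
    & forall p, p \in s -> exists i j, [/\ (i + j)%N = n, G i p.1 & G j p.2].

Record is_graded_dupdend (G : nat -> A -> Prop) : Prop := IsGradedDupDend {
  graded_dupdend : is_dupdend;
  graded_grading : is_grading G;
  graded_dot : forall m n x y, G m x -> G n y -> G (m + n)%N (x ** y);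
  graded_nwarrow : forall m n x y, G m x -> G n y -> G (m + n)%N (x \nw y);
  graded_prec : forall n x, G n x -> tens_degree G n (Dprec x);
  graded_succ : forall n x, G n x -> tens_degree G n (Dsucc x)
}.

End DupDend.

Section Morphisms.
Variable K : fieldType.

Record is_graded_morphism (A B : lmodType K)
    (HA : dupdend_ops A) (GA : nat -> A -> Prop)
    (HB : dupdend_ops B) (GB : nat -> B -> Prop)
    (phi : A -> B) : Prop := IsGradedMorphism {
  morph_linear : linear phi;
  morph_degree : forall n x, GA n x -> GB n (phi x);
  morph_dot : forall x y, phi (dot HA x y) = dot HB (phi x) (phi y);
  morph_nwarrow :
    forall x y, phi (nwarrow HA x y) = nwarrow HB (phi x) (phi y);
  morph_prec : forall x, tmap phi phi (cop_prec HA x) = cop_prec HB (phi x);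
  morph_succ : forall x, tmap phi phi (cop_succ HA x) = cop_succ HB (phi x)
}.

Definition is_graded_isomorphism (A B : lmodType K)
    (HA : dupdend_ops A) (GA : nat -> A -> Prop)
    (HB : dupdend_ops B) (GB : nat -> B -> Prop) (phi : A -> B) : Prop :=
  is_graded_morphism HA GA HB GB phi /\
  exists psi : B -> A,
    [/\ is_graded_morphism HB GB HA GA psi, cancel phi psi & cancel psi phi].

End Morphisms.

(* A planar tree is its root together with the left-to-right sequence of the
   planar trees grafted on it; a planar forest is a sequence of planar trees. *)
Inductive ptree (D : Type) : Type := PNode of D & seq (ptree D).

Definition pforest (D : Type) := seq (ptree D).

Section PTreeChoice.
Variable D : choiceType.

Fixpoint ptree_encode (t : ptree D) : GenTree.tree D :=
  let: PNode d ts := t in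
  GenTree.Node 0 (GenTree.Leaf d :: map ptree_encode ts).

Fixpoint ptree_decode (t : GenTree.tree D) : option (ptree D) :=
  if t is GenTree.Node _ (GenTree.Leaf d :: ts)
  then Some (PNode d (pmap ptree_decode ts)) else None.

Lemma ptree_encodeK : pcancel ptree_encode ptree_decode.
Proof.
rewrite /pcancel; fix IH 1 => -[d ts] /=; congr (Some (PNode _ _)).
by elim: ts => [|t ts IHts] //=; rewrite IH /= IHts.
Qed.

HB.instance Definition _ :=
  Choice.copy (ptree D) (pcan_type ptree_encodeK).

End PTreeChoice.

(* imap f [:: x0; x1; ...] = [:: f 0 x0; f 1 x1; ...] *)
Definition imap_from (T U : Type) (f : nat -> T -> U) :=
  fix loop (i : nat) (s : seq T) {struct s} : seq U :=
    if s is x :: s' then f i x :: loop i.+1 s' else [::].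

Notation imap f s := (imap_from f 0%N s).

(* A vertex of a forest is encoded by its address: the sequence i0, i1, ...
   such that the vertex is reached from the root of the i0-th tree by going to
   its i1-th child, and so on. In a tree, the root has the empty address. *)
Definition address := seq nat.

Fixpoint tree_addresses (D : Type) (t : ptree D) : seq address :=
  let: PNode _ ts := t in
  [::] :: flatten (imap (fun i t' => map (cons i) (tree_addresses t')) ts).

Definition addresses (D : Type) (F : pforest D) : seq address :=
  flatten (imap (fun i t => map (cons i) (tree_addresses t)) F).

Definition vertex (D : Type) (F : pforest D) := seq_sub (addresses F).

(* Address of the rightmost leaf (the empty address for the empty forest). *)
Fixpoint tree_rleaf (D : Type) (t : ptree D) : address :=
  let: PNode _ ts := t in
  last [::] (imap (fun i t' => i :: tree_rleaf t') ts).

Definition rleaf (D : Type) (F : pforest D) : address :=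
  last [::] (imap (fun i t => i :: tree_rleaf t) F).

(* Grafting of G at the vertex of address a, to the right of the children which
   that vertex already has. *)
Fixpoint tree_graft_at (D : Type) (G : pforest D) (a : address) (t : ptree D)
    : ptree D :=
  let: PNode d ts := t in
  if a is i :: a' then
    PNode d (imap (fun j t' => if j == i then tree_graft_at G a' t' else t') ts)
  else PNode d (ts ++ G).

Definition graft_at (D : Type) (G : pforest D) (a : address) (F : pforest D)
    : pforest D :=
  if a is i :: a' then
    imap (fun j t => if j == i then tree_graft_at G a' t else t) F
  else F.

Definition graft (D : Type) (F G : pforest D) : pforest D :=
  graft_at G (rleaf F) F.

(* The planar forest induced by F on the vertices whose address satisfies S,
   with the decorations and the left-to-right order inherited from F. When a
   vertex is discarded, the trees above it that remain take its place; this
   yields the subgraph induced by S as soon as no vertex outside S lies on a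
   path between two vertices of S, as is the case for Lea and Roo below. *)
Fixpoint tree_restrict (D : Type) (S : pred address) (t : ptree D)
    : pforest D :=
  let: PNode d ts := t in
  let F := flatten (imap (fun i => tree_restrict (fun a => S (i :: a))) ts) in
  if S [::] then [:: PNode d F] else F.

Definition restrict (D : Type) (S : pred address) (F : pforest D)
    : pforest D :=
  flatten (imap (fun i => tree_restrict (fun a => S (i :: a))) F).

Section Cuts.
Variables (D : Type) (F : pforest D).

(* edge w v: there is an edge from w to v, i.e., w is a child of v. *)
Definition edge (w v : vertex F) : bool :=
  val w == rcons (val v) (last 0%N (val w)).

(* path_to v w: there is an oriented path, possibly of length 0, from v to w. *)
Definition path_to (v w : vertex F) : bool := connect edge v w.

Definition admissible (V : {set vertex F}) : bool :=
  [forall v in V, forall w in V, (v != w) ==> ~~ path_to v w].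

Definition lea_vertices (V : {set vertex F}) : {set vertex F} :=
  [set w | [exists v in V, path_to w v]].

Definition subforest (W : {set vertex F}) : pforest D :=
  restrict (fun a => a \in [seq val w | w in W]) F.

Definition Lea (V : {set vertex F}) := subforest (lea_vertices V).
Definition Roo (V : {set vertex F}) := subforest (~: lea_vertices V).

Definition rleaf_in (W : {set vertex F}) : bool :=
  rleaf F \in [seq val w | w in W].

End Cuts.

Section HpD.
Variables (K : fieldType) (D : choiceType).

(* The space (H_p^D)_+, with basis the non-empty planar forests. *)
Definition neforest := {F : pforest D | F != [::]}.
Definition HpD := {malg K[neforest]}.

(* The basis vector of a non-empty forest (and 0 for the empty one, a case
   which never arises below). *)
Definition forest_vec (F : pforest D) : HpD :=
  if insub F is Some G then << G : neforest >> else 0.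

Definition bilinext (f : pforest D -> pforest D -> pforest D) (u v : HpD)
    : HpD :=
  linext (fun F : neforest =>
    linext (fun G : neforest => forest_vec (f (val F) (val G))) v) u.

Definition forest_cop_prec (F : pforest D) : tens HpD HpD :=
  \sum_(V : {set vertex F} | [&& admissible V, Lea V != [::], Roo V != [::]
                               & rleaf_in (lea_vertices V)])
    forest_vec (Lea V) \ox forest_vec (Roo V).

Definition forest_cop_succ (F : pforest D) : tens HpD HpD :=
  \sum_(V : {set vertex F} | [&& admissible V, Lea V != [::], Roo V != [::]
                               & rleaf_in (~: lea_vertices V)])
    forest_vec (Lea V) \ox forest_vec (Roo V).

Definition HpD_ops : dupdend_ops HpD := {|
  dot := bilinext cat;
  nwarrow := bilinext (@graft D);
  cop_prec := linext (fun F : neforest => forest_cop_prec (val F));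
  cop_succ := linext (fun F : neforest => forest_cop_succ (val F))
|}.

Definition bullet (d : D) : HpD := forest_vec [:: PNode d [::]].

Variable deg : D -> nat.

Fixpoint tree_degree (t : ptree D) : nat :=
  let: PNode d ts := t in (deg d + sumn (map tree_degree ts))%N.

Definition forest_degree (F : pforest D) : nat := sumn (map tree_degree F).

Definition HpD_degree (n : nat) (u : HpD) : Prop :=
  forall F : neforest, F \in msupp u -> forest_degree (val F) = n.

End HpD.

(* Main.v *)
From HB Require Import structures.
Require Import Defs.
From mathcomp Require Import all_boot all_order all_algebra.
From mathcomp Require Import finmap.
From mathcomp.classical Require Import boolp.
From mathcomp.classical Require classical_sets.
From mathcomp.multinomials Require Import monalg.

Set Implicit Arguments.
Unset Strict Implicit.
Unset Printing Implicit Defensive.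

Import GRing.Theory.
Local Open Scope ring_scope.

(* The map phi is forced on forests: F B_d(G) goes to phi(F) (p_d \nwarrow phi(G)),
   and it is a coalgebra morphism because the cuts of F B_d(G) are products of
   cuts of F and of B_d(G).

   Bijectivity rests on a triangularity. Every non-empty forest is uniquely
   b \nwarrow l with l = a . bullet_d (and b possibly empty). Counting the cuts of
   F with Lea = l and r_F in Lea, Roo = b, gives a matrix indexed by the pairs
   (l, b) and the forests F, which is unitriangular when (l, b) is identified
   with b \nwarrow l. Its entries are read off the coproducts of phi(F) in A by
   means of functionals chi_F dual to the phi(F), so that injectivity follows by
   induction on the number of vertices, the primitive p_d being independent.

   For surjectivity, by induction on the degree, both coproducts of x lie in the
   span of the phi(F) (x) phi(G); triangularity provides u in the image of phi
   with the same entries as x, and the coassociativity axioms then show that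
   x - u is primitive. *)

(** The homogeneous components of [A] may have infinite dimension, so bijectivity cannot come from
    comparing dimensions. What replaces this is a matrix whose columns are finite and whose
    triangularity is measured by a bounded height, together with functionals on [A] obtained from
    Zorn's lemma.

    Pairs [(l, b)] with [l] ending in a single vertex are the right rows because a cut whose Lea
    ends in this way and contains r_F cannot take any vertex of the rightmost branch of [b]: that
    would put a larger tree at the end of Lea.

    The obstacle is that the coproducts omit the trivial cuts, while the row [(l, empty)] counts
    exactly the full cut. For l = a . bullet_d with [a] non-empty, this row is recovered from the
    other coproduct: the parts [a] and bullet_d, with r_F in Roo, arise from the forest [l] only,
    and once. The rows [(bullet_d, empty)] are the only ones that no coproduct sees. They are the
    room left for the primitives: independence of the p_d settles them for injectivity, and spanning
    by the p_d for surjectivity. *)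

(** * Planar forests, their vertices and their up-closed sets of vertices *)

Section Forests.
Variable D : choiceType.
Implicit Types (t : ptree D) (F G : pforest D) (a : address) (S : pred address).

Lemma imap_from_rcons (T U : Type) (f : nat -> T -> U) i s x :
  imap_from f i (rcons s x) = rcons (imap_from f i s) (f (i + size s)%N x).
Proof. by elim: s i => [|y s IHs] i /=; rewrite ?addn0 // IHs addSnnS. Qed.

Lemma eq_imap_from (T U : Type) (f g : nat -> T -> U) i s :
  (forall j x, (j < i + size s)%N -> f j x = g j x) ->
  imap_from f i s = imap_from g i s.
Proof.
elim: s i => //= x s IHs i fg; rewrite fg ?IHs //; last by rewrite addnS ltnS leq_addr.
by move=> j y; rewrite addSnnS; apply: fg.
Qed.

Fixpoint tree_size t : nat := let: PNode _ ts := t in (sumn (map tree_size ts)).+1.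
Definition forest_size F : nat := sumn (map tree_size F).

Lemma forest_size_cat F G : forest_size (F ++ G) = (forest_size F + forest_size G)%N.
Proof. by rewrite /forest_size map_cat sumn_cat. Qed.

Lemma forest_size_rcons F d G :
  forest_size (rcons F (PNode d G)) = (forest_size F + (forest_size G).+1)%N.
Proof. by rewrite -cats1 forest_size_cat /= /forest_size /= addn0. Qed.

Lemma forest_size_eq0 F : (forest_size F == 0%N) = (F == [::]).
Proof. by case: F => // -[d ts] F. Qed.

(** The last tree is peeled off because the rightmost leaf and grafting both live there. The
    induction is on the number of vertices, so that it reaches the forest [G] of subtrees as well as
    [F]. *)
Lemma forest_ind (P : pforest D -> Prop) :
  P [::] ->
  (forall F d G, P F -> P G -> P (rcons F (PNode d G))) ->
  forall F, P F.
Proof.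
move=> P0 PS F; move: {2}(forest_size F) (leqnn (forest_size F)) => n.
elim: n F => [|n IHn] F.
  by rewrite leqn0 forest_size_eq0 => /eqP->.
case/lastP: F => [|F [d G]] //; rewrite forest_size_rcons addnS ltnS => le_n.
by apply: PS; apply: IHn; apply: leq_trans le_n; rewrite ?leq_addr ?leq_addl.
Qed.

Lemma addresses_rcons F d G :
  addresses (rcons F (PNode d G)) =
  addresses F ++ [:: size F] :: map (cons (size F)) (addresses G).
Proof. by rewrite /addresses imap_from_rcons flatten_rcons. Qed.

Lemma rleaf_rcons F d G : rleaf (rcons F (PNode d G)) = size F :: rleaf G.
Proof. by rewrite /rleaf imap_from_rcons last_rcons. Qed.

Lemma restrict_rcons S F d G :
  restrict S (rcons F (PNode d G)) =
  restrict S F ++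
    let R := restrict (fun a => S (size F :: a)) G in
    if S [:: size F] then [:: PNode d R] else R.
Proof. by rewrite /restrict imap_from_rcons flatten_rcons. Qed.

Lemma addresses_neq_nil F : [::] \notin addresses F.
Proof.
elim/forest_ind: F => // F d G IHF _.
rewrite addresses_rcons mem_cat negb_or IHF in_cons /=.
by apply/mapP=> -[].
Qed.

Lemma addresses_head F i a : i :: a \in addresses F -> (i < size F)%N.
Proof.
elim/forest_ind: F i a => // F d G IHF _ i a.
rewrite addresses_rcons size_rcons mem_cat in_cons => /or3P[/IHF||].
- exact: ltnW.
- by case/eqP=> ->.
- by case/mapP=> b _ [->].
Qed.

Lemma rleaf_addresses F : F != [::] -> rleaf F \in addresses F.
Proof.
elim/forest_ind: F => // F d G _ IHG _.
rewrite rleaf_rcons addresses_rcons mem_cat in_cons.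
have [->|/IHG rG] := eqVneq G [::]; first by rewrite eqxx orbT.
by rewrite map_f ?orbT.
Qed.

Lemma addresses_prefix F a b :
  a != [::] -> a ++ b \in addresses F -> a \in addresses F.
Proof.
elim/forest_ind: F a => // F d G IHF IHG [|i a] // _.
rewrite addresses_rcons !mem_cat !in_cons => /or3P[/IHF-> //||].
- by case: a => [/eqP[-> _]|? ? /eqP[]] //=; rewrite eqxx orbT.
case/mapP=> c cG [-> ac]; case: a ac => [|j a] ac; first by rewrite eqxx orbT.
by rewrite map_f ?orbT //; apply: IHG; rewrite // ac.
Qed.

Lemma eq_restrict S S' F : {in addresses F, S =1 S'} -> restrict S F = restrict S' F.
Proof.
elim/forest_ind: F S S' => // F d G IHF IHG S S' eqS.
rewrite !restrict_rcons /= eqS; last by rewrite addresses_rcons mem_cat !in_cons eqxx orbT.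
rewrite (IHF S S'); last by move=> a aF; rewrite eqS // addresses_rcons mem_cat aF.
rewrite (IHG _ (fun a => S' (size F :: a))) // => a aG.
by rewrite eqS // addresses_rcons mem_cat in_cons map_f // !orbT.
Qed.

Lemma restrictT F : restrict predT F = F.
Proof.
elim/forest_ind: F => // F d G IHF IHG.
by rewrite restrict_rcons /= IHF -[restrict _ G]/(restrict predT G) IHG cats1.
Qed.

Lemma restrict0 F : restrict pred0 F = [::].
Proof.
elim/forest_ind: F => // F d G IHF IHG.
by rewrite restrict_rcons /= IHF -[restrict _ G]/(restrict pred0 G) IHG.
Qed.

Definition upclosed F S := forall a b,
  a \in addresses F -> a ++ b \in addresses F -> S a -> S (a ++ b).

(** An up-closed set that contains the root is the whole tree, the first entry; any other one is a
    union of up-closed sets of the subtrees, chosen independently. *)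
Fixpoint tree_ideals t : seq (seq address) :=
  let: PNode _ ts := t in
  tree_addresses t ::
  foldl (fun acc L : seq (seq address) => [seq J0 ++ J | J0 <- acc, J <- L]) [:: [::]]
    (imap (fun i t' => map (map (cons i)) (tree_ideals t')) ts).

(* The up-closed sets of vertices of F (a vertex comes with all the vertices
   above it), as sublists of addresses F. *)
Definition ideals F : seq (seq address) :=
  foldl (fun acc L : seq (seq address) => [seq J0 ++ J | J0 <- acc, J <- L]) [:: [::]]
    (imap (fun i t => map (map (cons i)) (tree_ideals t)) F).

Lemma ideals_rcons F d G :
  ideals (rcons F (PNode d G)) =
  [seq J0 ++ map (cons (size F)) J | J0 <- ideals F,
     J <- ([::] :: addresses G) :: ideals G].
Proof.
rewrite /ideals imap_from_rcons foldl_rcons /= -/(ideals F).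
elim: (ideals F) => //= I s ->; congr (_ :: _ ++ _).
by rewrite -map_comp.
Qed.

Lemma ideals_sub F I : I \in ideals F -> {subset I <= addresses F}.
Proof.
elim/forest_ind: F I => [|F d G IHF IHG] I; first by rewrite inE => /eqP->.
rewrite ideals_rcons => /allpairsP[[I1 J] /= [I1F JG ->]] a.
rewrite addresses_rcons mem_cat => /orP[/(IHF _ I1F)|/mapP[b bJ ->]].
  by rewrite mem_cat => ->.
move: JG; rewrite mem_cat in_cons => /orP[/eqP JE|/IHG/(_ b bJ) bG].
  move: bJ; rewrite JE in_cons => /orP[/eqP->|bG]; first by rewrite in_cons eqxx orbT.
  by rewrite in_cons map_f ?orbT.
by rewrite in_cons map_f ?orbT.
Qed.

End Forests.

(** Addresses in [F] start with an index below [size F], those of the second block with [size F]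
    itself, so the two blocks do not interfere. *)
Lemma mem_ideal_join (D : choiceType) (F : pforest D) I1 (J : seq address) :
  {subset I1 <= addresses F} ->
  let I0 := I1 ++ map (cons (size F)) J in
  {in addresses F, mem I0 =1 mem I1} /\ forall b, (size F :: b \in I0) = (b \in J).
Proof.
move=> sI I0; split=> [a aF|b] /=; rewrite mem_cat.
  case: (a \in I1) => //=; apply/mapP=> -[b _ ab].
  by move: aF; rewrite ab => /addresses_head; rewrite ltnn.
rewrite mem_map; last by move=> ? ? [].
suff /negPf-> : size F :: b \notin I1 by [].
by apply/negP=> /sI/addresses_head; rewrite ltnn.
Qed.

Section Ideals.
Variable D : choiceType.
Implicit Types (t : ptree D) (F G : pforest D) (a : address) (S : pred address).

(** Since an ideal lists its vertices in the order of [addresses F], two ideals with the same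
    elements are the same sequence. This is what allows ideals to be compared as sets. *)
Lemma ideals_canonical F I :
  I \in ideals F -> [seq a <- addresses F | a \in I] = I.
Proof.
elim/forest_ind: F I => [|F d G IHF IHG] I; first by rewrite inE => /eqP->.
rewrite ideals_rcons => /allpairsP[[I1 J] /= [I1F JG ->]].
have [e1 e2] := mem_ideal_join J (ideals_sub I1F).
rewrite addresses_rcons filter_cat; congr (_ ++ _).
  by rewrite -[RHS](IHF _ I1F); apply/eq_in_filter => a /e1.
rewrite -map_cons filter_map; congr map.
rewrite (eq_filter (a2 := mem J)); last by move=> b /=; rewrite e2.
move: JG; rewrite in_cons => /orP[/eqP->|JG].
  by rewrite (eq_in_filter (a2 := predT)) ?filter_predT // => b /= ->.
rewrite /= IHG //; case: ifP => // nJ.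
by have /negP[] := addresses_neq_nil G; apply: (ideals_sub JG).
Qed.

Lemma ideals_uniq F : uniq (ideals F).
Proof.
elim/forest_ind: F => // F d G UF UG.
rewrite ideals_rcons; apply: allpairs_uniq => //.
  rewrite /= UG andbT; apply/negP => /ideals_sub/(_ [::]).
  by rewrite inE eqxx => /(_ isT); apply/negP/addresses_neq_nil.
move=> x y xs ys; case/allpairsP: xs => [[I1 J1] /= [I1F _ ->]].
case/allpairsP: ys => [[I2 J2] /= [I2F _ ->]] /= eI.
have [e1 _] := mem_ideal_join J1 (ideals_sub I1F).
have [e2 _] := mem_ideal_join J2 (ideals_sub I2F).
have eI12 : I1 = I2.
  rewrite -(ideals_canonical I1F) -(ideals_canonical I2F).
  by apply/eq_in_filter => a aF; rewrite -[LHS]e1 // -[RHS]e2 //= eI.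
move: eI; rewrite eI12 => /(congr1 (drop (size I2))); rewrite !drop_size_cat //.
by move/inj_map => -> // ? ? [].
Qed.

Lemma ideals_upclosed F I : I \in ideals F -> upclosed F (mem I).
Proof.
elim/forest_ind: F I => [|F d G IHF IHG] I //.
rewrite ideals_rcons => /allpairsP[[I1 J] /= [I1F JG ->]].
have [e1 e2] := mem_ideal_join J (ideals_sub I1F).
move=> a b; rewrite addresses_rcons mem_cat => + ab; case/orP=> [aF|].
  have abF : a ++ b \in addresses F.
    move: ab; rewrite mem_cat -map_cons => /orP[//|/mapP[c _]].
    case: a aF => [|i a] aF; first by have := addresses_neq_nil F; rewrite aF.
    by case=> ia _; move/addresses_head: aF; rewrite ia ltnn.
  move=> aI; rewrite [X in is_true X]e1 //.
  by apply: (IHF _ I1F) => //; rewrite -[mem I1 a]e1.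
rewrite -map_cons => /mapP[c cG ac]; move: ab; rewrite {a}ac => abF.
rewrite -[mem _ _]/(size F :: c \in _) -[mem _ (_ ++ b)]/(size F :: (c ++ b) \in _) !e2.
have cbG : c ++ b \in [::] :: addresses G.
  move: abF; rewrite mem_cat -map_cons => /orP[/addresses_head|]; first by rewrite ltnn.
  by rewrite cat_cons mem_map // => ? ? [].
move: JG; rewrite in_cons => /orP[/eqP->|JG] cJ //.
have cG' := ideals_sub JG cJ.
move: cbG; rewrite in_cons => /orP[cb|cbG]; last exact: (IHG _ JG).
by move: cG' (addresses_neq_nil G) cb; case: (c) => //= ->.
Qed.

Lemma filter_ideal F S : upclosed F S -> filter S (addresses F) \in ideals F.
Proof.
elim/forest_ind: F S => [|F d G IHF IHG] S uS; first by rewrite inE.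
rewrite ideals_rcons addresses_rcons filter_cat -map_cons filter_map.
have IF : filter S (addresses F) \in ideals F.
  by apply: IHF => a b aF abF; apply: uS; rewrite addresses_rcons mem_cat ?aF ?abF.
have nG b : b \in [::] :: addresses G -> size F :: b \in addresses (rcons F (PNode d G)).
  by move=> bG; rewrite addresses_rcons mem_cat -map_cons (map_f (cons _) bG) orbT.
apply/allpairsP; exists (filter S (addresses F), filter (fun a => S (size F :: a)) ([::] :: addresses G)).
split=> //=; rewrite in_cons; case: ifP => Sn.
  rewrite (eq_in_filter (a2 := predT)) ?filter_predT ?eqxx // => b bG /=.
  by apply: (uS [:: size F] b) => //; apply: nG; rewrite ?mem_head // in_cons bG orbT.
rewrite IHG ?orbT // => a b aG abG; rewrite -cat_cons; apply: uS; apply: nG.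
  by rewrite in_cons aG orbT.
by rewrite in_cons abG orbT.
Qed.

(* The triples (Lea, Roo, r_F \in Lea) over all admissible cuts of F, the two
   trivial ones included. *)
Definition cuts F : seq (pforest D * pforest D * bool) :=
  [seq (restrict (mem J) F, restrict (predC (mem J)) F, rleaf F \in J) | J <- ideals F].

Lemma cuts0 : cuts [::] = [:: ([::], [::], false)].
Proof. by []. Qed.

(** A cut of F B_d(G) pairs a cut of [F] with a cut of B_d(G), and the latter takes either the whole
    tree or only vertices of [G], its root then staying in Roo. The rightmost leaf lies in the last
    tree, so the flag is that of the second cut. For empty [G] the flag [false] of [cuts0] is the
    correct one, as the only vertex of the tree is then in Roo. *)
Lemma cuts_rcons F d G :
  cuts (rcons F (PNode d G)) =
  [seq (x.1.1 ++ y.1.1, x.1.2 ++ y.1.2, y.2) | x <- cuts F,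
     y <- ([:: PNode d G], [::], true) ::
          [seq (y.1.1, [:: PNode d y.1.2], y.2) | y <- cuts G]].
Proof.
rewrite /cuts ideals_rcons map_allpairs.
rewrite allpairs_mapl -!map_comp.
have -> : ([:: PNode d G], [::], true) ::
     [seq ((fun y => (y.1.1, [:: PNode d y.1.2], y.2)) \o
           (fun J => (restrict (mem J) G, restrict (predC (mem J)) G, rleaf G \in J))) J
     | J <- ideals G] =
  [seq (if [::] \in J then ([:: PNode d G], [::], true) else
     (restrict (mem J) G, [:: PNode d (restrict (predC (mem J)) G)], rleaf G \in J))
   | J <- ([::] :: addresses G) :: ideals G].
  rewrite map_cons mem_head; congr cons; apply/eq_in_map => J JG.
  case: ifP => // /(ideals_sub JG); by rewrite (negPf (addresses_neq_nil G)).
rewrite allpairs_mapr; apply/eq_in_allpairs => I1 J I1F JG.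
have [e1 e2] := mem_ideal_join J (ideals_sub I1F).
rewrite !restrict_rcons rleaf_rcons e2 /= e2.
rewrite (eq_restrict e1) (@eq_restrict _ (predC (mem (_ ++ _))) (predC (mem I1)) F); last first.
  by move=> a aF; apply: (congr1 negb (e1 a aF)).
move: JG; rewrite in_cons => /orP[/eqP JE|JG].
  rewrite {J}JE in e1 e2 *.
  rewrite mem_head /= (@eq_restrict _ (fun a => size F :: a \in _) predT G); last first.
    by move=> a aG; rewrite /= e2 in_cons aG orbT.
  rewrite (@eq_restrict _ (fun a => size F :: a \notin _) pred0 G); last first.
    by move=> a aG; rewrite /= e2 in_cons aG orbT.
  rewrite restrictT restrict0; congr (_, _, _).
  (* For empty [G], the default value [[::]] of [rleaf G] is the address of the root, which is
     indeed the rightmost leaf of the tree. *)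
  by have [->|/rleaf_addresses] := eqVneq G [::]; rewrite in_cons // => ->; rewrite orbT.
case: ifP => [/(ideals_sub JG)|_]; first by rewrite (negPf (addresses_neq_nil G)).
rewrite /= (@eq_restrict _ (fun a => size F :: a \in _) (mem J) G); last first.
  by move=> a aG; rewrite /= e2.
rewrite (@eq_restrict _ (fun a => size F :: a \notin _) (predC (mem J)) G) //.
by move=> a aG; rewrite /= e2.
Qed.

End Ideals.

(** * Admissible cuts correspond to up-closed sets of vertices *)

Section CutSums.
Variables (D : choiceType) (F : pforest D).
Implicit Types (u v w : vertex F) (W : {set vertex F}).

Lemma path_to_prefix v w : path_to v w = prefix (val w) (val v).
Proof.
apply/idP/prefixP => [/connectP[p]|[s]].
  elim: p v => [|u p IHp] v /=; first by move=> _ ->; exists [::]; rewrite cats0.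
  case/andP=> /eqP vu /IHp{}IHp /IHp[s us].
  by exists (rcons s (last 0%N (val v))); rewrite -rcons_cat -us.
elim/last_ind: s v => [|s i IHs] v vw.
  by rewrite (_ : v = w) ?/path_to ?connect0 //; apply: val_inj; rewrite vw cats0.
have wsF : val w ++ s \in addresses F.
  apply: (@addresses_prefix _ F _ [:: i]).
    by case E : (val w) (ssvalP w) => //=; rewrite E (negPf (addresses_neq_nil F)).
  by rewrite cats1 rcons_cat -vw; apply: ssvalP.
apply: connect_trans (IHs (SeqSub wsF) erefl).
by apply: connect1; rewrite /edge /= vw -rcons_cat last_rcons.
Qed.

Definition up_set W := [forall v in W, forall w, prefix (val v) (val w) ==> (w \in W)].

Definition minimal_vertices W :=
  [set v in W | [forall u in W, prefix (val u) (val v) ==> (u == v)]].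

Lemma up_setP W :
  reflect (forall v w, v \in W -> prefix (val v) (val w) -> w \in W) (up_set W).
Proof.
apply: (iffP forall_inP) => uW.
  by move=> v w /uW/forallP/(_ w)/implyP; apply.
by move=> v vW; apply/forallP=> w; apply/implyP; apply: uW.
Qed.

Lemma mem_lea_vertices (V : {set vertex F}) w :
  reflect (exists2 v, v \in V & prefix (val v) (val w)) (w \in lea_vertices V).
Proof.
rewrite inE; apply: (iffP exists_inP) => -[v vV]; rewrite ?path_to_prefix => vw;
  by exists v; rewrite ?path_to_prefix.
Qed.

Lemma up_set_lea V : up_set (lea_vertices V).
Proof.
apply/up_setP=> v w /mem_lea_vertices[u uV uv] vw; apply/mem_lea_vertices.
by exists u => //; apply: prefix_trans vw.
Qed.

Lemma lea_minimal W : up_set W -> lea_vertices (minimal_vertices W) = W.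
Proof.
move/up_setP=> uW; apply/setP=> w; apply/mem_lea_vertices/idP => [[v]|wW].
  by rewrite inE => /andP[vW _]; apply: uW.
pose P v := (v \in W) && prefix (val v) (val w).
have Pw : P w by rewrite /P wW prefix_refl.
case: (@arg_minnP _ w P (fun v => size (val v)) Pw) => v /andP[vW vw] vmin.
exists v => //; rewrite inE vW; apply/forall_inP=> u uW'; apply/implyP=> uv.
have := vmin u; rewrite /P uW' (prefix_trans uv vw) => /(_ isT).
case/prefixP: uv => s vs; rewrite vs size_cat -{2}[size (val u)]addn0 leq_add2l leqn0.
by move/eqP/size0nil=> s0; apply/eqP/val_inj; rewrite vs s0 cats0.
Qed.

(** Admissible cuts are the antichains, and an antichain is recovered as the set of minimal vertices
    of what lies above it. With [lea_minimal] this is the bijection between cuts and up-closed sets,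
    in the form required by [reindex_onto]. *)
Lemma minimal_lea V : (minimal_vertices (lea_vertices V) == V) = admissible V.
Proof.
have prefix_anti u v : prefix (val u) (val v) -> prefix (val v) (val u) -> u = v.
  case/prefixP=> s vs /prefixP[s' us].
  have /eqP : size (val v) = size (val v) by [].
  rewrite {1}vs us !size_cat -[X in _ == X]addn0 -addnA eqn_add2l addn_eq0.
  move=> /andP[_ /eqP/size0nil s0]; apply: val_inj; rewrite vs s0 cats0 //.
apply/eqP/forall_inP => [minV v vV|adm].
  apply/forall_inP=> w wV; apply/implyP; apply: contraNN.
  rewrite path_to_prefix => wv; rewrite eq_sym.
  move: vV; rewrite -minV inE => /andP[_ /forall_inP/(_ w)].
  rewrite wv; apply; apply/mem_lea_vertices; exists w => //; exact: prefix_refl.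
have admP v w : v \in V -> w \in V -> prefix (val w) (val v) -> v = w.
  move=> vV wV; rewrite -path_to_prefix => wv; apply/eqP; move: wv; apply: contraTT.
  by move/forall_inP: (adm v vV) => /(_ w wV)/implyP.
apply/setP=> v; rewrite inE; apply/andP/idP => [[/mem_lea_vertices[u uV uv]]|vV].
  move/forall_inP/(_ u); rewrite uv => h; rewrite -(eqP (h _)) //.
  by apply/mem_lea_vertices; exists u => //; exact: prefix_refl.
split; first by apply/mem_lea_vertices; exists v => //; exact: prefix_refl.
apply/forall_inP=> u /mem_lea_vertices[w wV wu]; apply/implyP=> uv.
have vw := admP v w vV wV (prefix_trans wu uv).
by apply/eqP; apply: prefix_anti => //; rewrite vw.
Qed.

Lemma sum_up_set (V : nmodType) (g : {set vertex F} -> V) :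
  \sum_(W | up_set W) g W =
  \sum_(J <- ideals F) g [set v | val v \in J].
Proof.
rewrite -big_filter -(big_map (fun J => [set v : vertex F | val v \in J]) xpredT).
apply: perm_big; apply: uniq_perm; first by rewrite filter_uniq // index_enum_uniq.
  rewrite map_inj_in_uniq ?ideals_uniq // => I1 I2 I1F I2F /setP eI.
  rewrite -(ideals_canonical I1F) -(ideals_canonical I2F).
  by apply/eq_in_filter=> a aF; have := eI (SeqSub aF); rewrite !inE.
move=> W; rewrite mem_filter mem_index_enum andbT.
apply/idP/mapP => [/up_setP uW|[I0 IF ->]].
  pose S a := a \in [seq val w | w in W].
  have SW w : S (val w) = (w \in W) by rewrite /S mem_map ?mem_enum //; apply: val_inj.
  exists (filter S (addresses F)).
    apply: filter_ideal => a b aF abF.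
    rewrite -[a]/(val (SeqSub aF)) SW => aW.
    rewrite -[_ ++ _]/(val (SeqSub abF)) SW; apply: uW aW _ => /=.
    exact: prefix_prefix.
  by apply/setP=> w; rewrite inE mem_filter SW ssvalP andbT.
apply/up_setP=> v w; rewrite !inE => vI /prefixP[s ws]; rewrite ws.
by apply: (ideals_upclosed IF) => //; rewrite -?ws; apply: ssvalP.
Qed.

(** The bridge from the sums that define the coproducts, over sets of vertices, to the list
    [cuts F], which obeys the recursion [cuts_rcons]. *)
Lemma sum_admissible (V : nmodType) (h : pforest D -> pforest D -> bool -> V) :
  \sum_(X : {set vertex F} | admissible X)
     h (Lea X) (Roo X) (rleaf_in (lea_vertices X)) =
  \sum_(c <- cuts F) h c.1.1 c.1.2 c.2.
Proof.
rewrite /cuts big_map /=.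
have -> : \sum_(J <- ideals F)
    h (restrict (mem J) F) (restrict (predC (mem J)) F) (rleaf F \in J) =
  \sum_(J <- ideals F) (fun W : {set vertex F} =>
      h (subforest W) (subforest (~: W)) (rleaf_in W)) [set v | val v \in J].
  rewrite big_seq [RHS]big_seq; apply: eq_bigr => J JF.
  have eJ a : (a \in [seq val w | w in [set v : vertex F | val v \in J]]) = (a \in J).
    apply/mapP/idP => [[v]|aJ]; first by rewrite mem_enum inE => ? ->.
    by exists (SeqSub (ideals_sub JF aJ)); rewrite ?mem_enum ?inE.
  rewrite /rleaf_in eJ /subforest.
  congr (h _ _ _); apply: eq_restrict => a aF /=; first by rewrite eJ.
  rewrite -[a]/(val (SeqSub aF)) mem_map ?mem_enum ?inE //; exact: val_inj.
rewrite -(sum_up_set (fun W => h (subforest W) (subforest (~: W)) (rleaf_in W))).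
rewrite [RHS](reindex_onto (@lea_vertices D F) minimal_vertices); last by move=> W /lea_minimal.
by apply: eq_big => // X; rewrite up_set_lea minimal_lea.
Qed.

Lemma rleaf_inC W : F != [::] -> rleaf_in (~: W) = ~~ rleaf_in W.
Proof.
move/rleaf_addresses=> rF; rewrite /rleaf_in -[rleaf F]/(val (SeqSub rF)).
by rewrite !mem_map ?mem_enum ?inE //; exact: val_inj.
Qed.

End CutSums.

(** * Counting cuts, and the decomposition of a forest at its rightmost leaf *)

Lemma count_allpairs (S T U : eqType) (f : S -> T -> U) (s : seq S) (t : seq T)
    (p : pred U) (q : pred S) (r : pred T) :
  {in s & t, forall x y, p (f x y) = q x && r y} ->
  count p [seq f x y | x <- s, y <- t] = (count q s * count r t)%N.
Proof.
elim: s => //= x s IHs pf.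
rewrite count_cat IHs; last by move=> y z ys zt; apply: pf; rewrite ?in_cons ?ys ?orbT.
rewrite mulnDl; congr addn; rewrite count_map.
rewrite (eq_in_count (a2 := fun y => q x && r y)); last first.
  by move=> y yt; apply: pf; rewrite ?mem_head.
by case: (q x); rewrite ?mul1n // mul0n count_pred0.
Qed.

Section CutCombinatorics.
Variable D : choiceType.
Implicit Types (t : ptree D) (F G a b l : pforest D) (c : pforest D * pforest D * bool).

Lemma mem_cuts_rcons F d G c :
  c \in cuts (rcons F (PNode d G)) ->
  exists2 x, x \in cuts F &
    c = (rcons x.1.1 (PNode d G), x.1.2, true) \/
    exists2 y, y \in cuts G &
      c = (x.1.1 ++ y.1.1, rcons x.1.2 (PNode d y.1.2), y.2).
Proof.
rewrite cuts_rcons => /allpairsP[[x y] /= [xF + ->]].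
rewrite in_cons => /orP[/eqP->|/mapP[z zG ->]]; exists x => //.
  by left; rewrite cats0 cats1.
by right; exists z; rewrite ?cats1.
Qed.

Lemma rcons_neq_nil (T : eqType) (s : seq T) x : rcons s x != [::].
Proof. by case: s. Qed.

Lemma cat_eq_nil (T : eqType) (s1 s2 : seq T) :
  (s1 ++ s2 == [::]) = (s1 == [::]) && (s2 == [::]).
Proof. by case: s1. Qed.

Lemma cuts_size F c :
  c \in cuts F -> (forest_size c.1.1 + forest_size c.1.2)%N = forest_size F.
Proof.
elim/forest_ind: F c => [|F d G IHF IHG] c; first by rewrite inE => /eqP->.
case/mem_cuts_rcons=> x /IHF xF [->|[y /IHG yG ->]] /=.
  by rewrite !forest_size_rcons -xF addnAC.
by rewrite !forest_size_rcons forest_size_cat -xF -yG addnACA !addnS.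
Qed.

Lemma cuts_lea0 F c : c \in cuts F -> c.1.1 = [::] -> c = ([::], F, false).
Proof.
elim/forest_ind: F c => [|F d G IHF IHG] c; first by rewrite inE => /eqP->.
case/mem_cuts_rcons=> x /IHF xF [->|[y /IHG yG ->]] /=.
  by move/eqP; rewrite (negPf (rcons_neq_nil _ _)).
by move/eqP; rewrite cat_eq_nil => /andP[/eqP/xF-> /eqP/yG->].
Qed.

Lemma cuts_roo0 F c : F != [::] -> c \in cuts F -> c.1.2 = [::] -> c = (F, [::], true).
Proof.
elim/forest_ind: F c => [|F d G IHF IHG] c // _.
case/mem_cuts_rcons=> x xF [->|[y /IHG yG ->]] /= => [x0|/eqP]; last first.
  by rewrite (negPf (rcons_neq_nil _ _)).
rewrite x0; suff -> : x.1.1 = F by [].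
have [F0|/IHF/(_ xF x0)-> //] := eqVneq F [::].
by move: xF; rewrite F0 inE => /eqP->.
Qed.

Lemma cuts_roo0_lea F c : c \in cuts F -> c.1.2 = [::] -> c.1.1 = F.
Proof.
have [->|F0 cF c0] := eqVneq F [::]; first by rewrite inE => /eqP->.
by rewrite (cuts_roo0 F0 cF c0).
Qed.

Lemma count_cuts_lea0 F : count (fun c => c.1.1 == [::]) (cuts F) = 1%N.
Proof.
elim/forest_ind: F => // F d G IHF IHG; rewrite cuts_rcons.
rewrite (count_allpairs (q := fun c => c.1.1 == [::]) (r := fun c => c.1.1 == [::])).
  by rewrite IHF mul1n /= count_map; exact: IHG.
by move=> x y _ _ /=; rewrite cat_eq_nil.
Qed.

Lemma count_cuts_roo0 F : count (fun c => c.1.2 == [::]) (cuts F) = 1%N.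
Proof.
elim/forest_ind: F => // F d G IHF IHG; rewrite cuts_rcons.
rewrite (count_allpairs (q := fun c => c.1.2 == [::]) (r := fun c => c.1.2 == [::])).
  by rewrite IHF /= count_map /= count_pred0.
by move=> x y _ _ /=; rewrite cat_eq_nil.
Qed.

Lemma cuts_roo_full F c : c \in cuts F -> (c.1.2 == F) = (c.1.1 == [::]).
Proof.
move=> cF; apply/eqP/eqP => [c2|/(cuts_lea0 cF)-> //].
apply/eqP; rewrite -forest_size_eq0 -(eqn_add2r (forest_size c.1.2)).
by rewrite (cuts_size cF) c2.
Qed.

Lemma count_cuts_roo_full F : count (fun c => c.1.2 == F) (cuts F) = 1%N.
Proof. by rewrite (eq_in_count (@cuts_roo_full F)) count_cuts_lea0. Qed.

Lemma graft_rcons F d G K :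
  graft (rcons F (PNode d G)) K =
  rcons F (PNode d (if G == [::] then K else graft G K)).
Proof.
rewrite /graft rleaf_rcons /= imap_from_rcons /= add0n eqxx.
congr rcons.
  rewrite (@eq_imap_from _ _ _ (fun _ t => t)); last first.
    by move=> j x; rewrite add0n ltn_neqAle => /andP[/negPf->].
  by elim: F 0%N => //= t F IHF i; rewrite IHF.
case: eqVneq => [-> //|].
case/lastP: G => // G [e L] _.
by rewrite rleaf_rcons.
Qed.

(** The empty [b] is singled out because [graft [::] l] is empty; here it acts as a left unit. *)
Definition plug b l := if b == [::] then l else graft b l.

Lemma plug_rcons F d G l : plug (rcons F (PNode d G)) l = rcons F (PNode d (plug G l)).
Proof. by rewrite /plug (negPf (rcons_neq_nil _ _)) graft_rcons. Qed.

Lemma plug_neq_nil b l : l != [::] -> plug b l != [::].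
Proof.
by case/lastP: b => // b [d G] _; rewrite plug_rcons rcons_neq_nil.
Qed.

Definition dot_ended l := if l is t :: l' then
  if last t l' is PNode _ [::] then true else false else false.

Lemma dot_endedP l : reflect (exists a d, l = rcons a (PNode d [::])) (dot_ended l).
Proof.
case/lastP: l => [|l [d G]]; first by right=> -[a [d]]; case: a.
have -> : dot_ended (rcons l (PNode d G)) = (G == [::]).
  by rewrite /dot_ended; case: l => [|u l] /=; rewrite ?last_rcons; case: G.
apply: (iffP eqP) => [->|[a [e /rcons_inj[_ _ ->]]] //].
by exists l, d.
Qed.

Lemma dot_ended_rcons l d G : dot_ended (rcons l (PNode d G)) = (G == [::]).
Proof.
apply/dot_endedP/eqP => [[a [e /rcons_inj[_ _ ->]]] //|->].
by exists l, d.
Qed.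

Lemma dot_ended_cat a l : l != [::] -> dot_ended (a ++ l) = dot_ended l.
Proof.
by case/lastP: l => // l [d G] _; rewrite -rcons_cat !dot_ended_rcons.
Qed.

(** [l] consists of all the trees grafted on the father of the rightmost leaf (of all of [F] if that
    leaf is a root). Once they are removed, the father is the rightmost leaf of [b]. *)
Lemma plug_surj F : F != [::] -> exists b l, dot_ended l /\ F = plug b l.
Proof.
elim/forest_ind: F => // F d G _ IHG _.
have [->|/IHG[b [l [dl ->]]]] := eqVneq G [::].
  by exists [::], (rcons F (PNode d [::])); rewrite dot_ended_rcons.
by exists (rcons F (PNode d b)), l; rewrite plug_rcons.
Qed.

Definition depth b := size (rleaf b).

Lemma depth_rcons F d G : depth (rcons F (PNode d G)) = (depth G).+1.
Proof. by rewrite /depth rleaf_rcons. Qed.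

Lemma depth_le b : (depth b <= forest_size b)%N.
Proof.
elim/forest_ind: b => // F d G _ IHG.
by rewrite depth_rcons forest_size_rcons addnS ltnS (leq_trans IHG) ?leq_addl.
Qed.

Lemma depth_eq0 b : (depth b == 0%N) = (b == [::]).
Proof. by case/lastP: b => // b [d G]; rewrite depth_rcons (negPf (rcons_neq_nil _ _)). Qed.

(* On pairs of fixed total size, this orders (depth b, forest_size l)
   lexicographically. *)
Definition height l b := (depth b * (forest_size l + forest_size b) + forest_size l)%N.

(** As Lea ends in a single vertex, it contains no vertex of the rightmost branch of [b], so this
    branch survives in Roo and Roo is at least as deep as [b]. It is strictly deeper when some of
    [l] remains on top of the branch. Otherwise Lea contains all of [l], and it is larger than [l]
    as soon as it also takes a vertex to the left of the branch. *)
Lemma cuts_dot_ended_lt b l c :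
  dot_ended l -> c \in cuts (plug b l) -> c.2 -> dot_ended c.1.1 ->
  (depth b < depth c.1.2)%N \/
  depth b = depth c.1.2 /\ ((forest_size l < forest_size c.1.1)%N \/ c = (l, b, true)).
Proof.
move=> dl; elim/forest_ind: b c => [|F d G _ IHG] c.
  rewrite /plug eqxx; case/dot_endedP: dl => a [e ->].
  case/mem_cuts_rcons=> x xa [->|[y]]; last by rewrite inE => /eqP-> ->.
  move=> _ _ /=; have [x0|] := eqVneq x.1.2 [::].
    by right; rewrite x0 (cuts_roo0_lea xa x0); split=> //; right.
  by rewrite -depth_eq0 -lt0n; left.
have G0 := plug_neq_nil G; rewrite plug_rcons.
have l0 : l != [::] by apply: contraTneq dl => ->.
case/mem_cuts_rcons=> x xF [->|[y yG ->]] /=.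
  by rewrite dot_ended_rcons (negPf (G0 l l0)).
move=> y2; have y0 : y.1.1 != [::].
  by apply: contraTneq y2 => /(cuts_lea0 yG)->.
rewrite dot_ended_cat // => dy.
rewrite !depth_rcons !ltnS.
case: (IHG y yG y2 dy) => [|[-> [lt|yE]]]; [by left|right; split=> //; left|].
  by rewrite forest_size_cat (leq_trans lt) ?leq_addl.
right; split; rewrite ?yE //=.
have [x0|x0] := eqVneq x.1.1 [::]; first by right; rewrite (cuts_lea0 xF x0).
by left; rewrite forest_size_cat -[X in (X < _)%N]add0n ltn_add2r lt0n forest_size_eq0.
Qed.

Lemma plug_size b l : l != [::] -> forest_size (plug b l) = (forest_size l + forest_size b)%N.
Proof.
move=> l0; elim/forest_ind: b => [|F d G _ IHG]; first by rewrite /plug eqxx addn0.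
by rewrite plug_rcons !forest_size_rcons IHG -addnS addnCA.
Qed.

Lemma height_lt b l c :
  dot_ended l -> c \in cuts (plug b l) -> c.2 -> dot_ended c.1.1 ->
  c != (l, b, true) -> (height l b < height c.1.1 c.1.2)%N.
Proof.
move=> dl cF c2 dc cN; have l0 : l != [::] by apply: contraTneq dl => ->.
rewrite /height (cuts_size cF) (plug_size b l0).
have [lt|[-> [lt|cE]]] := cuts_dot_ended_lt dl cF c2 dc.
(* One more level of depth is worth the total size [n], which bounds [forest_size l]; strictness
   comes from Lea being non-empty. *)
- set n := (forest_size l + _)%N.
apply: (@leq_ltn_trans (depth b * n + n)%N); first by rewrite leq_add2l leq_addr.
rewrite -mulSnr (@leq_ltn_trans (depth c.1.2 * n)%N) ?leq_mul2r ?lt ?orbT //.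
rewrite -[X in (X < _)%N]addn0 ltn_add2l lt0n forest_size_eq0.
by apply: contraTneq dc => ->.
- by rewrite ltn_add2l.
- by rewrite cE eqxx in cN.
Qed.

Lemma height_le l b :
  (height l b <= (forest_size l + forest_size b).+1 * (forest_size l + forest_size b))%N.
Proof.
rewrite /height mulSnr leq_add ?leq_addr // leq_mul2r.
by rewrite (leq_trans (depth_le b)) ?leq_addl ?orbT.
Qed.

(** The diagonal of the cut matrix: along the branch, the prescribed Roo forces the cut to take
    nothing from the trees on the left, and at the top it forces the full cut of [l]. *)
Lemma count_cuts_plug b l :
  dot_ended l -> count_mem (l, b, true) (cuts (plug b l)) = 1%N.
Proof.
move=> dl; elim/forest_ind: b => [|F d G _ IHG].
  rewrite /plug eqxx; case/dot_endedP: dl => a [e ->]; rewrite cuts_rcons.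
  rewrite (count_allpairs (q := fun x => x.1.2 == [::]) (r := fun x => x.2)).
    by rewrite count_cuts_roo0.
  move=> x y xa; rewrite !inE => /orP[]/eqP-> /=; rewrite -?andbA ?andbF; last first.
    by apply/negP => /eqP[].
  rewrite cats0 cats1; apply/eqP/andP => [[_ ->] //|[/eqP x0 _]].
  by rewrite x0 (cuts_roo0_lea xa x0).
rewrite plug_rcons cuts_rcons.
rewrite (count_allpairs (q := fun x => x.1.2 == F)
  (r := fun y => y == (l, [:: PNode d G], true))).
  rewrite count_cuts_roo_full mul1n /= !xpair_eqE /= andbF add0n count_map -IHG.
  apply: eq_count => -[[y1 y2] y3] /=; rewrite !xpair_eqE /= eqseq_cons andbT.
  congr (_ && _ && _); by apply/eqP/eqP => [[]|->].
have l0 : l != [::] by apply: contraTneq dl => ->.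
move=> x y xF; rewrite in_cons => /orP[/eqP->|/mapP[z zG ->]] /=.
  have -> : (([:: PNode d (plug G l)], [::], true) == (l, [:: PNode d G], true)) = false.
    by rewrite !xpair_eqE andbF.
  rewrite cats0 cats1 andbF !xpair_eqE; apply/negbTE/negP => /andP[/andP[/eqP E _] _]; move: dl; rewrite -E dot_ended_rcons.
  by apply/negP/plug_neq_nil.
rewrite cats1 !xpair_eqE eqseq_rcons eqseq_cons andbT.
case: (eqVneq x.1.2 F) => [x0|_]; last by rewrite andbF.
by move: (cuts_roo_full xF); rewrite x0 eqxx => /esym/eqP->.
Qed.

Lemma cuts_plug_height b l b' l' :
  dot_ended l -> dot_ended l' -> (l', b', true) \in cuts (plug b l) ->
  (l', b') != (l, b) -> (height l b < height l' b')%N.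
Proof.
move=> dl dl' cF cN; apply: (height_lt dl cF) => //=.
by move: cN; rewrite !xpair_eqE andbT.
Qed.

End CutCombinatorics.

(** * Inverting the unitriangular matrix of cut multiplicities *)

Section CutMatrix.
Variables (K : fieldType) (D : choiceType).
Implicit Types (F G a b l : pforest D).

Definition cut_mult l b F := count_mem (l, b, true) (cuts F).

(** The row [(l, b)] meets [plug b l] with coefficient 1 and otherwise only forests of smaller
    height, whose coefficients vanish by induction. *)
Lemma cut_matrix_inj (s : seq (pforest D)) (c : pforest D -> K) :
  uniq s -> [::] \notin s ->
  (forall l b, dot_ended l -> \sum_(F <- s) c F * (cut_mult l b F)%:R = 0) ->
  forall F, F \in s -> c F = 0.
Proof.
move=> us s0 cM; have nz F : F \in s -> F != [::] by apply: contraTneq => ->.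
suff cP n l b : (height l b < n)%N -> dot_ended l -> plug b l \in s -> c (plug b l) = 0.
  by move=> F Fs; have [b [l [dl E]]] := plug_surj (nz _ Fs); rewrite E in Fs *; exact: (cP (height l b).+1).
elim: n l b => // n IHn l b; rewrite ltnS => le_n dl ls.
rewrite -(cM l b dl) (bigD1_seq _ ls us) /= /cut_mult count_cuts_plug // mulr1.
rewrite big1_seq ?addr0 // => F /andP[FN Fs].
have [cF|/count_memPn->] := boolP ((l, b, true) \in cuts F); last by rewrite mulr0.
have [b' [l' [dl' E]]] := plug_surj (nz _ Fs); rewrite E in cF Fs FN *.
rewrite IHn ?mul0r //; apply: leq_trans le_n; apply: cuts_plug_height => //.
by apply: contraNneq FN => -[-> ->].
Qed.

Definition mult_sum (u : seq (K * pforest D)) l b : K :=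
  \sum_(x <- u) x.1 * (cut_mult l b x.2)%:R.

(** The off-diagonal entries in the column of [plug b l] have larger height and the same total
    number of vertices, so they can be cancelled by solutions already obtained. The induction is on
    the distance to the bound [height_le], which depends on that total only; this makes it end
    although the matrix is infinite. *)
Lemma cut_matrix_solve l b : dot_ended l ->
  exists2 u : seq (K * pforest D), (forall x, x \in u -> x.2 != [::]) &
    forall l' b', dot_ended l' -> mult_sum u l' b' = ((l', b') == (l, b))%:R.
Proof.
move: {2}(_ - height l b)%N (erefl ((forest_size l + forest_size b).+1 *
  (forest_size l + forest_size b) - height l b)%N) => n.
elim/ltn_ind: n l b => n IHn l b En dl.
(* [O] lists the off-diagonal entries of the column, and [U] is the sum of their solutions, with
   multiplicities. *)
pose O := [seq c <- cuts (plug b l) | [&& c.2, dot_ended c.1.1 & c != (l, b, true)]].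
have l0 : l != [::] by apply: contraTneq dl => ->.
have [U U0 UP] : exists2 u : seq (K * pforest D), (forall x, x \in u -> x.2 != [::]) &
    forall l' b', dot_ended l' -> mult_sum u l' b' = (count_mem (l', b', true) O)%:R.
  have : forall c, c \in O -> exists2 u : seq (K * pforest D), (forall x, x \in u -> x.2 != [::]) &
    forall l' b', dot_ended l' -> mult_sum u l' b' = (c == (l', b', true))%:R.
    move=> [[l1 b1] c3]; rewrite mem_filter /= => /andP[/and3P[h3 dl1 cN] cF].
    rewrite {c3}h3 in cN cF *.
    have lt : (height l b < height l1 b1)%N.
      by apply: cuts_plug_height => //; apply: contraNneq cN => -[-> ->].
    have E : (forest_size l1 + forest_size b1 = forest_size l + forest_size b)%N.
      by rewrite (cuts_size cF) plug_size.
    have [|u u0 uP] := IHn _ _ l1 b1 (erefl _) dl1.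
      by rewrite -En E ltn_sub2l // (leq_trans lt) // -E height_le.
    exists u => // l' b' dl'; rewrite uP //.
    by rewrite eq_sym !xpair_eqE andbT.
  elim: O => [|c O IHO] cO; first by exists [::] => // *; rewrite /mult_sum big_nil.
  have [|u u0 uP] := IHO; first by move=> x xO; apply: cO; rewrite in_cons xO orbT.
  have [v v0 vP] := cO _ (mem_head _ _).
  exists (v ++ u) => [x|l' b' dl']; first by rewrite mem_cat => /orP[/v0|/u0].
  by rewrite /mult_sum big_cat -/(mult_sum _ _ _) -/(mult_sum u _ _) uP // vP //= natrD.
exists ((1, plug b l) :: [seq (- x.1, x.2) | x <- U]) => [x|l' b' dl'].
  rewrite in_cons => /orP[/eqP->|/mapP[y /U0 y0 ->]] //=; exact: plug_neq_nil.
rewrite /mult_sum big_cons big_map /= mul1r.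
under eq_bigr do rewrite mulNr.
rewrite sumrN -/(mult_sum _ _ _) UP // /cut_mult count_filter.
apply/eqP; rewrite subr_eq -natrD; apply/eqP; congr (_%:R).
have [[-> ->]|N] := eqVneq (l', b') (l, b).
  rewrite count_cuts_plug // (eq_count (a2 := pred0)) ?count_pred0 // => c /=.
  by case: (eqVneq c (l, b, true)); rewrite ?andbF.
rewrite add0n; apply: eq_count => c /=; case: (eqVneq c (l', b', true)) => //= ->.
by rewrite dl' /=; apply/esym; apply: contraNneq N => -[-> ->].
Qed.

End CutMatrix.

(** * Separating and dual functionals on a space of arbitrary dimension *)

Section Linear.
Variables (K : fieldType) (V W : lmodType K).

Definition linear_of (f : V -> W) (f_lin : linear f) : {linear V -> W} :=
  HB.pack_for {linear V -> W} f (GRing.isLinear.Build K V W *:%R f f_lin).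

Lemma linear_ofE f (f_lin : linear f) x : linear_of f_lin x = f x.
Proof. by []. Qed.

End Linear.

Section Functional.
Variables (K : fieldType) (V : lmodType K) (P : V -> Prop) (w : V).
Hypotheses (subP : subspace P) (nPw : ~ P w).

Import mathcomp.classical.classical_sets.

Lemma maximal_avoiding_subspace : exists M : V -> Prop,
  [/\ subspace M, forall x, P x -> M x, ~ M w &
      forall v, ~ M v -> exists c, M (w - c *: v)].
Proof.
(* The union with [P] takes care of the empty chain in Zorn's lemma: its union is the empty set,
   which [U] turns into the subspace [P]. *)
pose U (A : set V) (x : V) := A x \/ P x.
pose good (A : set V) := subspace (U A) /\ ~ U A w.
have [F Fgood Ftot|A [[A_sub nAw] Amax]] := @Zorn_bigcup V good.
  split; last by case=> [[X FX Xw]|//]; case: (Fgood X FX) => _ []; left.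
  split; first by right; case: subP.
  move=> c x y [[X FX Xx]|Px] [[Y FY Yy]|Py].
  - have [XY|YX] := Ftot _ _ FX FY.
      have [[_ h] _] := Fgood Y FY.
      by case: (h c x y (or_introl (XY _ Xx)) (or_introl Yy)); [left; exists Y|right].
    have [[_ h] _] := Fgood X FX.
    by case: (h c x y (or_introl Xx) (or_introl (YX _ Yy))); [left; exists X|right].
  - have [[_ h] _] := Fgood X FX.
    by case: (h c x y (or_introl Xx) (or_intror Py)); [left; exists X|right].
  - have [[_ h] _] := Fgood Y FY.
    by case: (h c x y (or_intror Px) (or_introl Yy)); [left; exists Y|right].
  - by right; apply: subP.2.
exists (U A); split=> // [x Px|v nAv]; first by right.
pose B : set V := fun x => exists c y, U A y /\ x = c *: v + y.
have UB x : U B x -> B x.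
  case=> // Px; exists 0, x; split; first by right.
  by rewrite scale0r add0r.
have AB : (A `<` B)%classic.
  split=> [x Ax|BA].
    by exists 0, x; split; [left|rewrite scale0r add0r].
  apply: nAv; left; apply: BA; exists 1, 0; split; first exact: A_sub.1.
  by rewrite scale1r addr0.
have /not_andP[nB|/contrapT/UB[c [y [Ay ->]]]] := Amax _ AB; last first.
  by exists c; rewrite addrAC subrr add0r.
case: nB; split; first by right; case: subP.
move=> c x y /UB[c1 [x1 [Ax ->]]] /UB[c2 [y2 [Ay ->]]]; left.
exists (c * c1 + c2), (c *: x1 + y2); split; first exact: A_sub.2.
by rewrite scalerDr scalerA addrACA -scalerDl.
Qed.

(** Maximality makes [M] a complement of the line spanned by [w], and [f] is the coordinate along
    that line. *)
Lemma separating_functional : exists f : {linear V -> K^o},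
  f w = 1 /\ forall x, P x -> f x = 0.
Proof.
have [M [[M0 M_lin] PM nMw Mmax]] := maximal_avoiding_subspace.
have MZ c x : M x -> M (c *: x) by move=> Mx; rewrite -[_ *: _]addr0; exact: M_lin.
have MB x y : M x -> M y -> M (x - y).
  by move=> Mx My; rewrite addrC -scaleN1r; exact: M_lin.
have coefP x : exists c : K, M (x - c *: w).
  have [Mx|/Mmax[c Mc]] := pselect (M x); first by exists 0; rewrite scale0r subr0.
  have c0 : c != 0 by apply: contra_notN nMw => /eqP c0; rewrite c0 scale0r subr0 in Mc.
  exists c^-1; have := MZ (- c^-1) _ Mc.
  by rewrite scalerBr scalerA mulNr mulVf // !scaleNr scale1r opprK addrC.
pose f x : K^o := projT1 (cid (coefP x)).
have fP x c : M (x - c *: w) -> f x = c.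
  rewrite /f; case: cid => d /= Md Mc; apply/eqP; rewrite -subr_eq0.
  apply: contra_notT nMw => cd.
  have := MZ (d - c)^-1 _ (MB _ _ Mc Md).
  have -> : x - c *: w - (x - d *: w) = (d - c) *: w.
    by rewrite opprB addrC addrA subrK scalerBl.
  by rewrite scalerA mulVf // scale1r.
have f_lin : linear f.
  move=> c x y; apply: fP; rewrite /f; case: cid => d /= Md; case: cid => e /= Me.
  have := M_lin c _ _ Md Me.
  by rewrite scalerBr scalerA addrACA -opprD -scalerDl.
exists (linear_of f_lin); split=> [|x /PM Mx]; apply: fP.
  by rewrite scale1r subrr.
by rewrite scale0r subr0.
Qed.

End Functional.

(** [f i] separates [v i] from the span of the other vectors. The predicate [Q] serves first for the
    forests of bounded size, inside the induction that proves freeness, and then for all non-empty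
    forests. *)
Lemma dual_functionals (K : fieldType) (V : lmodType K) (I : eqType) (Q : pred I)
    (v : I -> V) :
  (forall (s : seq I) (c : I -> K), uniq s -> all Q s ->
     \sum_(i <- s) c i *: v i = 0 -> forall i, i \in s -> c i = 0) ->
  exists f : I -> {linear V -> K^o},
    forall i j, Q i -> Q j -> f i (v j) = (i == j)%:R.
Proof.
move=> v_free.
suff fP i : exists f : {linear V -> K^o}, Q i -> forall j, Q j -> f (v j) = (i == j)%:R.
  by exists (fun i => projT1 (cid (fP i))) => i j Qi Qj; case: cid => f /= ->.
have [Qi|nQi] := boolP (Q i); last first.
  by exists \0%VF.
pose P x := exists (s : seq I) (c : I -> K),
  [/\ uniq s, all Q s, i \notin s & x = \sum_(j <- s) c j *: v j].
have extend (s t : seq I) (c : I -> K) : uniq s -> uniq t -> {subset s <= t} ->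
    \sum_(j <- s) c j *: v j = \sum_(j <- t) (if j \in s then c j else 0) *: v j.
  move=> us ut st; rewrite [RHS](bigID (fun j => j \in s)) /= [X in _ + X]big1; last first.
    by move=> j /negPf->; rewrite scale0r.
  rewrite addr0 -[RHS]big_filter.
  have st' : perm_eq s [seq j <- t | j \in s].
    apply: uniq_perm => // [|j]; first exact: filter_uniq.
    by rewrite mem_filter; case: (boolP (j \in s)) => // /st.
  rewrite -(perm_big _ st') /=.
  by apply: eq_big_seq => j ->.
have [||f [fi f0]] := @separating_functional K V P (v i).
- split; first by exists [::], (fun=> 0); rewrite big_nil.
  move=> c x y [s [a [us Qs is_ ->]]] [t [b [ut Qt it ->]]].
  exists (undup (s ++ t)), (fun j => c * (if j \in s then a j else 0) +
     (if j \in t then b j else 0)).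
  rewrite undup_uniq mem_undup mem_cat negb_or is_ it; split=> //.
    by apply/allP=> j; rewrite mem_undup mem_cat => /orP[/(allP Qs)|/(allP Qt)].
  rewrite (extend s (undup (s ++ t))) ?undup_uniq //; last first.
    by move=> j js; rewrite mem_undup mem_cat js.
  rewrite (extend t (undup (s ++ t))) ?undup_uniq //; last first.
    by move=> j js; rewrite mem_undup mem_cat js orbT.
  rewrite scaler_sumr -big_split; apply: eq_bigr => j _ /=.
  by rewrite scalerDl scalerA.
- case=> s [c [us Qs is_ vE]].
  pose c' j := if j == i then -1 else c j.
  suff: c' i = 0 by apply/eqP; rewrite /c' eqxx oppr_eq0 oner_eq0.
  apply: (v_free (i :: s)); rewrite /= ?mem_head ?is_ ?us ?Qi //.
  rewrite big_cons /c' eqxx scaleN1r vE addrC; apply/eqP; rewrite subr_eq0; apply/eqP.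
  apply: eq_big_seq => j js.
  by case: eqP => // ji; rewrite -ji js in is_.
exists f => _ j Qj; have [<-|ij] := eqVneq i j; first exact: fi.
apply: f0; exists [:: j], (fun=> 1); rewrite big_seq1 scale1r; split=> //=.
  by rewrite Qj.
by rewrite inE.
Qed.

(** * Bilinear maps, and contraction of tensors with functionals *)

Section Bilinear.
Variables (K : fieldType).

Lemma bilinear_comp (A B A' B' V W : lmodType K) (f : A' -> B' -> V)
    (h : V -> W) (g1 : A -> A') (g2 : B -> B') :
  bilinear_map f -> linear h -> linear g1 -> linear g2 ->
  bilinear_map (fun a b => h (f (g1 a) (g2 b))).
Proof.
move=> [f1 f2] hl l1 l2; split=> [b|a] c x y /=.
  by rewrite l1 -hl; congr h; exact: (f1 _ c).
by rewrite l2 -hl; congr h; exact: (f2 _ c).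
Qed.

Lemma linear_id (V : lmodType K) : linear (@id V). Proof. by []. Qed.

Lemma tpure_bilinear_comp (A B A' B' : lmodType K) (g1 : A -> A') (g2 : B -> B') :
  linear g1 -> linear g2 -> bilinear_map (fun a b => g1 a \ox g2 b).
Proof.
by move=> l1 l2; exact: (bilinear_comp (tpure_bilinear A' B') (@linear_id _) l1 l2).
Qed.

Lemma tpurePl (A B : lmodType K) (b : B) k (x y : A) :
  (k *: x + y) \ox b = k *: (x \ox b) + y \ox b.
Proof. exact: (tpure_bilinear A B).1. Qed.

Lemma tpurePr (A B : lmodType K) (a : A) k (x y : B) :
  a \ox (k *: x + y) = k *: (a \ox x) + a \ox y.
Proof. exact: (tpure_bilinear A B).2. Qed.

Lemma tlift_sum (A B V : lmodType K) (f : A -> B -> V) (f_bil : bilinear_map f)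
    (I : Type) (s : seq I) (P : pred I) (a : I -> A) (b : I -> B) :
  tlift f (\sum_(i <- s | P i) a i \ox b i) = \sum_(i <- s | P i) f (a i) (b i).
Proof.
rewrite -(linear_ofE (tlift_is_linear f_bil)) linear_sum.
by apply: eq_bigr => i _; exact: tlift_tpure.
Qed.

Lemma tmap_tpure (A B A' B' : lmodType K) (f : A -> A') (g : B -> B') a b :
  linear f -> linear g -> tmap f g (a \ox b) = f a \ox g b.
Proof. by move=> fl gl; rewrite /tmap tlift_tpure //; exact: tpure_bilinear_comp. Qed.

Lemma tmap_linear (A B A' B' : lmodType K) (f : A -> A') (g : B -> B') :
  linear f -> linear g -> linear (tmap f g).
Proof. by move=> fl gl; apply: tlift_is_linear; exact: tpure_bilinear_comp. Qed.

Lemma eq_linear_tens (A B V : lmodType K) (f g : tens A B -> V) :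
  linear f -> linear g -> (forall a b, f (a \ox b) = g (a \ox b)) -> f =1 g.
Proof.
move=> fl gl fg t; have [s ->] := tens_span t.
rewrite -(linear_ofE fl) -(linear_ofE gl) !linear_sum.
by apply: eq_bigr => i _; exact: fg.
Qed.

Lemma linear_comp (U V W : lmodType K) (f : V -> W) (g : U -> V) :
  linear f -> linear g -> linear (fun x => f (g x)).
Proof. by move=> fl gl c x y; rewrite gl fl. Qed.

Lemma linear_scaleD (V W : lmodType K) (k : K) (f g : V -> W) :
  linear f -> linear g -> linear (fun x => k *: f x + g x).
Proof.
by move=> fl gl c x y; rewrite fl gl !scalerDr !scalerA [k * c]mulrC addrACA.
Qed.

Lemma bilinear_assoc (A B C T V : lmodType K) (f : A -> T -> V) (g : B -> C -> T) :
  bilinear_map f -> bilinear_map g ->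
  bilinear_map (fun (u : tens A B) (c : C) => \sw_(a, b <- u) f a (g b c)).
Proof.
move=> [fl fr] [gl gr].
have bl (c : C) : bilinear_map (fun a b => f a (g b c)).
  split=> [b|a] k x y /=; first exact: fl.
  by have /= -> := gl c k x y; exact: fr.
split=> [c|u] k x y /=; first exact: (tlift_is_linear (bl c)).
have Fl (c : C) := tlift_is_linear (bl c).
move: u; apply: eq_linear_tens => [||a b]; first exact: Fl.
  exact: (linear_scaleD _ (Fl x) (Fl y)).
have E c := tlift_tpure (bl c) a b; rewrite !E.
by have /= -> := gr b k x y; exact: fr.
Qed.

End Bilinear.

Section Evaluation.
Variables (K : fieldType) (A B : lmodType K).
Implicit Types (f : {linear A -> K^o}) (g : {linear B -> K^o}).

Lemma linearPw (U V : lmodType K) (f : {linear U -> V}) : linear f.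
Proof. by move=> c x y; exact: linearP. Qed.

(* Locked, for linear_sum not to see through to the linear structure of linext. *)
Definition evl f : tens A B -> B := locked (fun t => \sw_(a, b <- t) (f a : K) *: b).
Definition evr g : tens A B -> A := locked (fun t => \sw_(a, b <- t) (g b : K) *: a).
Definition ev f g (t : tens A B) : K^o := f (evr g t).

Lemma evl_bilinear f : bilinear_map (fun (a : A) (b : B) => (f a : K) *: b).
Proof.
split=> [b|a] c x y /=; first by rewrite linearP scalerDl scalerA.
by rewrite scalerDr !scalerA mulrC.
Qed.

Lemma evr_bilinear g : bilinear_map (fun (a : A) (b : B) => (g b : K) *: a).
Proof.
split=> [b|a] c x y /=; last by rewrite linearP scalerDl scalerA.
by rewrite scalerDr !scalerA mulrC.
Qed.

Lemma evl_is_linear f : linear (evl f).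
Proof. by rewrite /evl; unlock; exact: tlift_is_linear (evl_bilinear f). Qed.

Lemma evr_is_linear g : linear (evr g).
Proof. by rewrite /evr; unlock; exact: tlift_is_linear (evr_bilinear g). Qed.

HB.instance Definition _ f :=
  GRing.isLinear.Build K (tens A B) B *:%R (evl f) (evl_is_linear f).
HB.instance Definition _ g :=
  GRing.isLinear.Build K (tens A B) A *:%R (evr g) (evr_is_linear g).

Lemma ev_is_linear f g : linear (ev f g).
Proof. by move=> c x y; rewrite /ev !linearP. Qed.
HB.instance Definition _ f g :=
  GRing.isLinear.Build K (tens A B) K^o *:%R (ev f g) (ev_is_linear f g).

Lemma evl_tpure f a b : evl f (a \ox b) = (f a : K) *: b.
Proof. by rewrite /evl; unlock; rewrite tlift_tpure //; exact: evl_bilinear. Qed.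

Lemma evr_tpure g a b : evr g (a \ox b) = (g b : K) *: a.
Proof. by rewrite /evr; unlock; rewrite tlift_tpure //; exact: evr_bilinear. Qed.

Lemma ev_tpure f g a b : ev f g (a \ox b) = f a * g b.
Proof. by rewrite /ev evr_tpure linearZ /= mulrC. Qed.

Lemma ev_evl f g t : ev f g t = g (evl f t).
Proof.
apply: (@eq_linear_tens _ _ _ _ _ (fun t => g (evl f t))) => [||a b].
- exact: linearPw.
- exact: (linear_comp (linearPw g) (linearPw (evl f))).
- by rewrite ev_tpure evl_tpure linearZ.
Qed.

End Evaluation.

Section TripleEvaluation.
Variables (K : fieldType) (A : lmodType K).
Implicit Types (f g h : {linear A -> K^o}) (t : tens A A).

Lemma tassoc_bilinear (B C : lmodType K) :
  bilinear_map (fun (u : tens A B) (c : C) => \sw_(a, b <- u) a \ox (b \ox c)).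
Proof. exact: bilinear_assoc (tpure_bilinear _ _) (tpure_bilinear _ _). Qed.

(** Contracting the three legs with [f], [g], [h] turns the identities in the threefold tensor
    product into identities between scalars. With [ev_tmap], each dendriform axiom then moves a
    contraction from one side of a coproduct to the other. *)
Lemma ev_tassoc_tmap (P : A -> tens A A) f g h t : linear P ->
  ev g h (evl f (tassoc (tmap P id t))) = ev f g (P (evr h t)).
Proof.
move=> Pl; have Tl : linear (@tassoc K A A A) := tlift_is_linear (@tassoc_bilinear A A).
apply: (@eq_linear_tens _ _ _ _ (fun t => ev g h (evl f (tassoc (tmap P id t))))
  (fun t => ev f g (P (evr h t)))) => [||a c].
- exact: (linear_comp (linearPw (ev g h)) (linear_comp (linearPw (evl f))
    (linear_comp Tl (tmap_linear Pl (@linear_id _ _))))).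
- exact: (linear_comp (linearPw (ev f g)) (linear_comp Pl (linearPw (evr h)))).
rewrite tmap_tpure // evr_tpure.
have -> : P ((h c : K) *: a) = (h c : K) *: P a := linearZ_LR (linear_of Pl) _ _.
rewrite linearZ /=.
rewrite /tassoc tlift_tpure; last exact: tassoc_bilinear.
have [s ->] := tens_span (P a).
rewrite tlift_sum; last first.
  apply: (@tpure_bilinear_comp _ _ _ _ _ id (fun b => b \ox c)) => // k x y.
  exact: tpurePl.
rewrite (linear_sum (evl f)) (linear_sum (ev g h)) (linear_sum (ev f g)) scaler_sumr.
apply: eq_bigr => i _; rewrite /= evl_tpure linearZ /= !ev_tpure.
exact: etrans (mulrA _ _ _) (mulrC _ _).
Qed.

Lemma ev_tmap (Q : A -> tens A A) f g h t : linear Q ->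
  ev g h (evl f (tmap id Q t)) = ev g h (Q (evl f t)).
Proof.
move=> Ql; congr (ev g h _).
apply: (@eq_linear_tens _ _ _ _ (fun t => evl f (tmap id Q t))
  (fun t => Q (evl f t))) => [||a c].
- exact: (linear_comp (linearPw (evl f)) (tmap_linear (@linear_id _ _) Ql)).
- exact: (linear_comp Ql (linearPw (evl f))).
rewrite tmap_tpure // !evl_tpure; exact/esym/(linearZ_LR (linear_of Ql)).
Qed.

Variables (H : dupdend_ops A) (H_dend : is_dendriform_coalg H).
Local Notation Dprec := (cop_prec H).
Local Notation Dsucc := (cop_succ H).

Lemma cop_linear : linear (cop H).
Proof.
move=> c x y; rewrite /cop (cop_prec_linear H_dend) (cop_succ_linear H_dend).
by rewrite scalerDr addrACA.
Qed.

Lemma ev_coprec_coprec f g h x :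
  ev f g (Dprec (evr h (Dprec x))) = ev g h (cop H (evl f (Dprec x))).
Proof.
rewrite -ev_tassoc_tmap; last exact: cop_prec_linear.
by rewrite coprec_coprec // ev_tmap //; exact: cop_linear.
Qed.

Lemma ev_cosucc_coprec f g h x :
  ev f g (Dsucc (evr h (Dprec x))) = ev g h (Dprec (evl f (Dsucc x))).
Proof.
rewrite -ev_tassoc_tmap; last exact: cop_succ_linear.
by rewrite cosucc_coprec // ev_tmap //; exact: cop_prec_linear.
Qed.

Lemma ev_cop_cosucc f g h x :
  ev f g (cop H (evr h (Dsucc x))) = ev g h (Dsucc (evl f (Dsucc x))).
Proof.
rewrite -ev_tassoc_tmap; last exact: cop_linear.
by rewrite cop_cosucc // ev_tmap //; exact: cop_succ_linear.
Qed.

End TripleEvaluation.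

(** * Sums over cuts, with the two trivial cuts split off *)

Lemma filter_singleton (T : eqType) (s : seq T) (a : pred T) x :
  count a s = 1%N -> (forall y, y \in s -> a y -> y = x) -> filter a s = [:: x].
Proof.
rewrite -size_filter => s1 sx.
have : {in filter a s, forall y, y = x}.
  by move=> y; rewrite mem_filter => /andP[ay /sx->].
case: (filter a s) s1 => [|y [|z t]] // _ ex.
by rewrite (ex y) ?mem_head.
Qed.

Section CutSplitting.
Variables (D : choiceType) (V : nmodType).
Implicit Types (F : pforest D).

Definition proper_cut (c : pforest D * pforest D * bool) :=
  (c.1.1 != [::]) && (c.1.2 != [::]).

Lemma sum_cuts F (k : pforest D * pforest D * bool -> V) : F != [::] ->
  \sum_(c <- cuts F) k c =
  k (F, [::], true) + k ([::], F, false) + \sum_(c <- cuts F | proper_cut c) k c.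
Proof.
move=> F0; rewrite (bigID (fun c => c.1.2 == [::])) /= -addrA; congr (_ + _).
  rewrite -big_filter (@filter_singleton _ _ _ (F, [::], true)) ?big_seq1 //.
    exact: count_cuts_roo0.
  by move=> c cF /eqP; exact: cuts_roo0.
rewrite (bigID (fun c => c.1.1 == [::])) /=; congr (_ + _).
  rewrite -big_filter (@filter_singleton _ _ _ ([::], F, false)) ?big_seq1 //.
    rewrite -[RHS](count_cuts_lea0 F); apply: eq_in_count => c cF /=.
    case: (eqVneq c.1.1 [::]) => [/(cuts_lea0 cF)->|_]; last by rewrite andbF.
    by rewrite /= F0.
  by move=> c cF /andP[_ /eqP]; exact: cuts_lea0.
by apply: eq_bigl => c; rewrite andbC.
Qed.

(** Each flag selects exactly one trivial cut: the full one has r_F in Lea, the empty one has it in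
    Roo. In the coproduct of a product these give the terms in which a factor is left uncut. *)
Lemma sum_cuts_flag F b (k : pforest D * pforest D * bool -> V) : F != [::] ->
  \sum_(c <- cuts F | c.2 == b) k c =
  (if b then k (F, [::], true) else k ([::], F, false)) +
  \sum_(c <- cuts F | proper_cut c && (c.2 == b)) k c.
Proof.
move=> F0; rewrite big_mkcond sum_cuts //= -big_mkcondr.
by case: b; rewrite /= ?addr0 ?add0r.
Qed.

Lemma cuts_tree d (G : pforest D) :
  cuts [:: PNode d G] = ([:: PNode d G], [::], true) ::
    [seq (y.1.1, [:: PNode d y.1.2], y.2) | y <- cuts G].
Proof.
rewrite -[X in cuts X]/(rcons [::] (PNode d G)) cuts_rcons /= cats0 -map_comp.
by congr (_ :: _); apply: eq_map => -[[]].
Qed.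

Lemma sum_cuts_rcons F d G b (k : pforest D * pforest D * bool -> V) :
  \sum_(c <- cuts (rcons F (PNode d G)) | c.2 == b) k c =
  \sum_(x <- cuts F) \sum_(y <- cuts [:: PNode d G] | y.2 == b)
    k (x.1.1 ++ y.1.1, x.1.2 ++ y.1.2, y.2).
Proof.
rewrite cuts_rcons -cuts_tree big_mkcond big_allpairs_dep.
by apply: eq_bigr => x _; rewrite -big_mkcond.
Qed.

Lemma sum_cuts_tree d (G : pforest D) b (k : pforest D * pforest D * bool -> V) :
  \sum_(c <- cuts [:: PNode d G] | proper_cut c && (c.2 == b)) k c =
  \sum_(y <- cuts G | (y.1.1 != [::]) && (y.2 == b)) k (y.1.1, [:: PNode d y.1.2], y.2).
Proof.
rewrite cuts_tree big_cons /proper_cut /= big_map.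
by apply: eq_bigl => y; rewrite andbT.
Qed.

End CutSplitting.

Section TensorSums.
Variables (K : fieldType) (A : lmodType K) (m1 m2 : A -> A -> A).
Hypotheses (m1_bil : bilinear_map m1) (m2_bil : bilinear_map m2).
Variables (I J : Type) (s : seq I) (t : seq J) (P : pred I) (Q : pred J).
Variables (a b : I -> A) (c d : J -> A).

Lemma tlift2_sum :
  \sw_(x1, x2 <- \sum_(i <- s | P i) a i \ox b i)
    \sw_(y1, y2 <- \sum_(j <- t | Q j) c j \ox d j) m1 x1 y1 \ox m2 x2 y2 =
  \sum_(i <- s | P i) \sum_(j <- t | Q j) m1 (a i) (c j) \ox m2 (b i) (d j).
Proof.
have -> : (fun x1 x2 => \sw_(y1, y2 <- \sum_(j <- t | Q j) c j \ox d j) m1 x1 y1 \ox m2 x2 y2) =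
  (fun x1 x2 => \sum_(j <- t | Q j) m1 x1 (c j) \ox m2 x2 (d j)).
  apply/funext => x1; apply/funext => x2; apply: tlift_sum.
  by apply: tpure_bilinear_comp; [exact: m1_bil.2|exact: m2_bil.2].
apply: tlift_sum; split=> [x2|x1] k u v /=; rewrite scaler_sumr -big_split;
  apply: eq_bigr => j _ /=.
  rewrite -(tpure_bilinear A A).1; congr (_ \ox _); exact: (m1_bil.1 _ k).
rewrite -(tpure_bilinear A A).2; congr (_ \ox _); exact: (m2_bil.1 _ k).
Qed.

End TensorSums.

(** * The values of forests in [A] and their coproducts *)

Section ForestValue.
Variables (K : fieldType) (A : lmodType K) (H : dupdend_ops A) (D : choiceType).
Variable p : D -> A.
Implicit Types (F G : pforest D) (t : ptree D).

Local Notation "x ** y" := (dot H x y) (at level 40, left associativity).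
Local Notation "x \nw y" := (nwarrow H x y) (at level 40, left associativity).
Local Notation Dprec := (cop_prec H).
Local Notation Dsucc := (cop_succ H).

(** [A] has no unit, so products start from their first factor and a leaf is treated separately. *)
Fixpoint tree_val t : A :=
  let: PNode d ts := t in
  if map tree_val ts is v :: vs then p d \nw foldl (dot H) v vs else p d.

(* The image of a forest under phi. The value 0 of the empty forest is junk. *)
Definition forest_val F : A :=
  if map tree_val F is v :: vs then foldl (dot H) v vs else 0.

Lemma tree_val_PNode d G :
  tree_val (PNode d G) = if G == [::] then p d else p d \nw forest_val G.
Proof. by case: G. Qed.

Lemma forest_val_rcons F t :
  forest_val (rcons F t) = if F == [::] then tree_val t else forest_val F ** tree_val t.
Proof. by case: F => // u F; rewrite /forest_val /= map_rcons foldl_rcons. Qed.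

Lemma forest_val_tree t : forest_val [:: t] = tree_val t.
Proof. by []. Qed.

Hypothesis H_dup : is_duplicial H.

Lemma forest_val_cat F G : F != [::] -> G != [::] ->
  forest_val (F ++ G) = forest_val F ** forest_val G.
Proof.
move=> F0; elim/last_ind: G => // G t IHG _.
rewrite -rcons_cat !forest_val_rcons cat_eq_nil (negPf F0) /=.
by case: eqVneq IHG => [->|G0 IHG]; rewrite ?cats0 // IHG // (dotA H_dup).
Qed.

(** The axioms on (x y) \nwarrow z and (x \nwarrow y) \nwarrow z push the graft into the last factor
    and then up the rightmost branch, following [graft_rcons]. *)
Lemma forest_val_graft F G : F != [::] -> G != [::] ->
  forest_val (graft F G) = forest_val F \nw forest_val G.
Proof.
elim/forest_ind: F => // F d F' _ IHF _ G0.
rewrite graft_rcons !forest_val_rcons !tree_val_PNode.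
have -> : (if F' == [::] then G else graft F' G) == [::] = false.
  by have := plug_neq_nil F' G0; rewrite /plug => /negPf->.
have -> : p d \nw forest_val (if F' == [::] then G else graft F' G) =
    (if F' == [::] then p d else p d \nw forest_val F') \nw forest_val G.
  by case: eqVneq IHF => // F'0 ->; rewrite ?(nwarrowA H_dup).
by case: (F == [::]); rewrite ?(dot_nwarrowA H_dup).
Qed.

End ForestValue.

Section ForestCoproduct.
Variables (K : fieldType) (A : lmodType K) (H : dupdend_ops A) (D : choiceType).
Variable p : D -> A.
Hypotheses (H_dd : is_dupdend H) (p_prim : forall d, prim_tot H (p d)).
Implicit Types (F G : pforest D) (t : ptree D).

Local Notation "x ** y" := (dot H x y) (at level 40, left associativity).
Local Notation "x \nw y" := (nwarrow H x y) (at level 40, left associativity).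
Local Notation Dprec := (cop_prec H).
Local Notation Dsucc := (cop_succ H).
Local Notation fval := (forest_val H p).
Local Notation tval := (tree_val H p).

Let dotB : bilinear_map (dot H) := dot_bilinear (dupdend_dup H_dd).
Let nwB : bilinear_map (nwarrow H) := nwarrow_bilinear (dupdend_dup H_dd).

Lemma dotl_linear y : linear (fun x => x ** y). Proof. exact: dotB.1. Qed.
Lemma dotr_linear x : linear (fun y => x ** y). Proof. exact: dotB.2. Qed.
Lemma nwl_linear y : linear (fun x => x \nw y). Proof. exact: nwB.1. Qed.
Lemma nwr_linear x : linear (fun y => x \nw y). Proof. exact: nwB.2. Qed.

Definition cut_tensor (c : pforest D * pforest D * bool) : tens A A :=
  fval c.1.1 \ox fval c.1.2.

Definition cut_sum b F : tens A A :=
  \sum_(c <- cuts F | proper_cut c && (c.2 == b)) cut_tensor c.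

Section Expand.
Variables (g1 g2 : A -> A) (g1l : linear g1) (g2l : linear g2).

Lemma tlift_cut_sum b F :
  \sw_(x1, x2 <- cut_sum b F) g1 x1 \ox g2 x2 =
  \sum_(c <- cuts F | proper_cut c && (c.2 == b)) g1 (fval c.1.1) \ox g2 (fval c.1.2).
Proof. exact: (tlift_sum (tpure_bilinear_comp g1l g2l)). Qed.

Lemma cut_sumD (V : nmodType) F (k : pforest D * pforest D * bool -> V) :
  \sum_(c <- cuts F | proper_cut c) k c =
  \sum_(c <- cuts F | proper_cut c && (c.2 == true)) k c +
  \sum_(c <- cuts F | proper_cut c && (c.2 == false)) k c.
Proof.
rewrite (bigID (fun c => c.2)) /=; congr (_ + _);
  by apply: eq_bigl => c; rewrite ?eqb_id ?eqbF_neg.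
Qed.

Lemma tlift_cut_sum_all F :
  \sw_(x1, x2 <- \sum_(c <- cuts F | proper_cut c) cut_tensor c) g1 x1 \ox g2 x2 =
  \sum_(c <- cuts F | proper_cut c) g1 (fval c.1.1) \ox g2 (fval c.1.2).
Proof. exact: (tlift_sum (tpure_bilinear_comp g1l g2l)). Qed.

Lemma tlift_tpure0 : \sw_(x1, x2 <- (0 : tens A A)) g1 x1 \ox g2 x2 = 0.
Proof.
have := tlift_sum (tpure_bilinear_comp g1l g2l) (Nil (A * A)) xpredT fst snd.
by rewrite !big_nil.
Qed.

End Expand.

Lemma tlift2_tpure0 b G (m1 m2 : A -> A -> A) : bilinear_map m1 -> bilinear_map m2 ->
  \sw_(x1, x2 <- (0 : tens A A)) \sw_(y1, y2 <- cut_sum b G) m1 x1 y1 \ox m2 x2 y2 = 0.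
Proof.
move=> m1B m2B.
have := tlift2_sum m1B m2B (Nil (A * A)) (cuts G) xpredT
  (fun c => proper_cut c && (c.2 == b)) fst snd (fun c => fval c.1.1) (fun c => fval c.1.2).
by rewrite !big_nil.
Qed.

Definition cop_is_cut_sum x F := Dprec x = cut_sum true F /\ Dsucc x = cut_sum false F.

Lemma cop_cut_sum x F : cop_is_cut_sum x F ->
  cop H x = \sum_(c <- cuts F | proper_cut c) cut_tensor c.
Proof. by case=> xp xs; rewrite /cop xp xs [RHS]cut_sumD. Qed.

Lemma cut_sum_tree b d G : G != [::] ->
  cut_sum b [:: PNode d G] =
  (if b then fval G \ox p d else 0) +
  \sum_(c <- cuts G | proper_cut c && (c.2 == b)) fval c.1.1 \ox (p d \nw fval c.1.2).
Proof.
move=> G0; rewrite /cut_sum sum_cuts_tree big_mkcondl sum_cuts_flag //=.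
rewrite G0; congr (_ + _); apply: eq_bigr => c /andP[/andP[c1 c2] _].
by rewrite c1 /cut_tensor /= forest_val_tree tree_val_PNode (negPf c2).
Qed.

(** As [p d] is primitive, only the terms without coproducts of the left argument survive in the
    axioms for \nwarrow. They match the cuts of [G] with non-empty Lea, the root staying in Roo: the
    full cut gives the leading term of the first coproduct, the proper cuts give the rest. *)
Lemma cop_tree d G : (G != [::] -> cop_is_cut_sum (fval G) G) ->
  cop_is_cut_sum (tval (PNode d G)) [:: PNode d G].
Proof.
have [prec0 succ0] := p_prim d.
rewrite tree_val_PNode; have [->|G0 /(_ isT) [prec succ]] := eqVneq G [::].
  move=> _; rewrite /cop_is_cut_sum /cut_sum prec0 succ0 !sum_cuts_tree cuts0.
  by rewrite !big_cons !big_nil.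
rewrite /cop_is_cut_sum !cut_sum_tree // add0r; split.
  rewrite (cop_prec_nwarrow H_dd) prec0 succ0 prec.
  rewrite (tlift_cut_sum (@linear_id _ _) (nwr_linear _)).
  rewrite (tlift_tpure0 (nwl_linear _) (@linear_id _ _)).
  rewrite (tlift_tpure0 (dotl_linear _) (@linear_id _ _)).
  by rewrite (tlift2_tpure0 true G dotB nwB) !addr0.
rewrite (cop_succ_nwarrow H_dd) succ0 succ.
rewrite (tlift_cut_sum (@linear_id _ _) (nwr_linear _)).
rewrite (tlift_tpure0 (@linear_id _ _) (nwl_linear _)).
by rewrite (tlift2_tpure0 false G dotB nwB) !addr0.
Qed.

Section DotSums.
Variables (F : pforest D) (d : D) (G : pforest D).
Hypothesis F0 : F != [::].
Local Notation T := [:: PNode d G].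

Lemma inner_cut_sum b l r :
  \sum_(y <- cuts T | y.2 == b)
    (if proper_cut (l ++ y.1.1, r ++ y.1.2, y.2) then
       cut_tensor (l ++ y.1.1, r ++ y.1.2, y.2) else 0) =
  (if b then if r == [::] then 0 else fval (l ++ T) \ox fval r
   else if l == [::] then 0 else fval l \ox fval (r ++ T)) +
  \sum_(y <- cuts T | proper_cut y && (y.2 == b))
     fval (l ++ y.1.1) \ox fval (r ++ y.1.2).
Proof.
rewrite sum_cuts_flag // /proper_cut /= !cat_eq_nil !andbF /=.
congr (_ + _); first by case: b; rewrite ?cats0 ?andbT ?andbF //; case: eqVneq.
by apply: eq_bigr => y /andP[/andP[/negPf y1 /negPf y2] _]; rewrite !cat_eq_nil y1 y2 !andbF.
Qed.

(** The five terms, in the order of the axioms for the product, come from a cut [x] of [F] and a cut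
    [y] of the last tree: both trivial, of opposite kinds; [x] proper and [y] the trivial cut of
    flag [b]; [x] full and [y] proper; [x] empty and [y] proper; both proper. *)
Lemma cut_sum_rcons b :
  cut_sum b (rcons F (PNode d G)) =
  (if b then fval T \ox fval F else fval F \ox fval T)
  + \sum_(x <- cuts F | proper_cut x)
      (if b then (fval x.1.1 ** fval T) \ox fval x.1.2
       else fval x.1.1 \ox (fval x.1.2 ** fval T))
  + \sum_(y <- cuts T | proper_cut y && (y.2 == b)) (fval F ** fval y.1.1) \ox fval y.1.2
  + \sum_(y <- cuts T | proper_cut y && (y.2 == b)) fval y.1.1 \ox (fval F ** fval y.1.2)
  + \sum_(x <- cuts F | proper_cut x) \sum_(y <- cuts T | proper_cut y && (y.2 == b))
      (fval x.1.1 ** fval y.1.1) \ox (fval x.1.2 ** fval y.1.2).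
Proof.
have dup := dupdend_dup H_dd.
have catE := forest_val_cat p dup.
rewrite {1}/cut_sum big_mkcondl sum_cuts_rcons (sum_cuts _ F0) !inner_cut_sum.
rewrite [(F, _, _).1.1]/= [(F, _, _).1.2]/= [([::], _, _).1.1]/= [([::], _, _).1.2]/=.
rewrite eqxx (negPf F0) /=.
have E1 : \sum_(y <- cuts T | proper_cut y && (y.2 == b)) fval (F ++ y.1.1) \ox fval ([::] ++ y.1.2) =
  \sum_(y <- cuts T | proper_cut y && (y.2 == b)) (fval F ** fval y.1.1) \ox fval y.1.2.
  by apply: eq_bigr => y /andP[/andP[y1 y2] _]; rewrite /= catE.
have E2 : \sum_(y <- cuts T | proper_cut y && (y.2 == b)) fval ([::] ++ y.1.1) \ox fval (F ++ y.1.2) =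
  \sum_(y <- cuts T | proper_cut y && (y.2 == b)) fval y.1.1 \ox (fval F ** fval y.1.2).
  by apply: eq_bigr => y /andP[/andP[y1 y2] _]; rewrite /= catE.
rewrite {}E1 {}E2.
under eq_bigr do rewrite inner_cut_sum.
rewrite big_split /=.
have -> : \sum_(x <- cuts F | proper_cut x)
    (if b then if x.1.2 == [::] then 0 else fval (x.1.1 ++ T) \ox fval x.1.2
     else if x.1.1 == [::] then 0 else fval x.1.1 \ox fval (x.1.2 ++ T)) =
  \sum_(x <- cuts F | proper_cut x)
    (if b then (fval x.1.1 ** fval T) \ox fval x.1.2
     else fval x.1.1 \ox (fval x.1.2 ** fval T)).
  by apply: eq_bigr => x /andP[x1 x2]; rewrite (negPf x1) (negPf x2) !catE.
have -> : \sum_(x <- cuts F | proper_cut x) \sum_(y <- cuts T | proper_cut y && (y.2 == b))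
    fval (x.1.1 ++ y.1.1) \ox fval (x.1.2 ++ y.1.2) =
  \sum_(x <- cuts F | proper_cut x) \sum_(y <- cuts T | proper_cut y && (y.2 == b))
      (fval x.1.1 ** fval y.1.1) \ox (fval x.1.2 ** fval y.1.2).
  apply: eq_bigr => x /andP[x1 x2]; apply: eq_bigr => y /andP[/andP[y1 y2] _].
  by rewrite !catE.
set S2 := \sum_(x <- cuts F | proper_cut x) _.
set S3 := \sum_(y <- cuts T | _) _.
set S4 := \sum_(y <- cuts T | _) _.
set S5 := \sum_(x <- cuts F | proper_cut x) _.
have -> : (if b then 0 else fval F \ox fval T) + S3 + ((if b then fval T \ox fval F else 0) + S4)
  = (if b then fval T \ox fval F else fval F \ox fval T) + (S3 + S4).
  by case: (b); rewrite !add0r; [exact: addrCA|exact/esym/addrA].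
by rewrite addrACA !addrA.
Qed.

End DotSums.

Lemma cop_forest_val F : F != [::] -> cop_is_cut_sum (fval F) F.
Proof.
elim/forest_ind: F => // F d G IHF IHG _.
have [precT succT] := cop_tree d IHG.
rewrite forest_val_rcons; case: (eqVneq F [::]) IHF => [-> _|F0 /(_ isT) FP]; first by split.
have [precF succF] := FP; rewrite /cop_is_cut_sum !cut_sum_rcons // !forest_val_tree.
have copF := cop_cut_sum FP.
split.
  rewrite (cop_prec_dot H_dd) copF precT.
  rewrite (tlift_cut_sum_all (dotl_linear _) (@linear_id _ _)).
  rewrite (tlift_cut_sum (dotr_linear _) (@linear_id _ _)).
  rewrite (tlift_cut_sum (@linear_id _ _) (dotr_linear _)).
  congr (_ + _); exact: (tlift2_sum dotB dotB).
rewrite (cop_succ_dot H_dd) copF succT.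
rewrite (tlift_cut_sum_all (@linear_id _ _) (dotl_linear _)).
rewrite (tlift_cut_sum (dotr_linear _) (@linear_id _ _)).
rewrite (tlift_cut_sum (@linear_id _ _) (dotr_linear _)).
congr (_ + _); exact: (tlift2_sum dotB dotB).
Qed.

End ForestCoproduct.

(** * Linear independence of the values of forests *)

Section BulletCuts.
Variable D : choiceType.
Implicit Types (F G l r : pforest D).

Lemma cut_mult_roo0 l F : l != [::] -> F != [::] -> cut_mult l [::] F = (F == l).
Proof.
move=> l0 F0; rewrite /cut_mult; have [<-|Fl] := eqVneq F l.
  rewrite -[RHS](count_cuts_roo0 F); apply: eq_in_count => c cF /=.
  by apply/eqP/eqP => [->|/(cuts_roo0 F0 cF)].
apply/count_memPn; apply: contraNN Fl => cF.
by have /= -> := cuts_roo0_lea cF erefl.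
Qed.

(** Roo contains, along with r_F, all the vertices below it. If Roo is a single vertex, then r_F is
    both a root and a leaf, and everything else is in Lea. *)
Lemma count_cuts_bullet a d F :
  count_mem (a, [:: PNode d [::]], false) (cuts F) = (F == rcons a (PNode d [::])).
Proof.
have [->|FN] := eqVneq F (rcons a (PNode d [::])).
  rewrite cuts_rcons (count_allpairs (q := fun x => x.1.2 == [::]) (r := fun x => ~~ x.2)).
    by rewrite count_cuts_roo0.
  move=> x y xa; rewrite cuts0 !inE => /orP[]/eqP-> /=; rewrite ?andbF.
    by apply/negbTE/negP => /eqP[].
  rewrite cats0 cats1 !xpair_eqE !andbT.
  apply/andP/eqP => [[_]|x0]; last by rewrite x0 (cuts_roo0_lea xa x0) !eqxx.
  by move/eqP/(congr1 size); rewrite size_rcons => -[/size0nil].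
apply/count_memPn; apply: contraNN FN; case/lastP: F => [|F [e G]]; first by rewrite inE => /eqP.
case/mem_cuts_rcons=> x xF [|[y yG]] [] // -> E y2.
have {E} [x0 [<- y0]] : x.1.2 = [::] /\ d = e /\ y.1.2 = [::].
  have x0 : x.1.2 = [::] by move/(congr1 size): E; rewrite size_rcons => -[/esym/size0nil].
  by move: E; rewrite x0 => -[-> <-].
have [G0|G0] := eqVneq G [::]; last by move: y2; rewrite (cuts_roo0 G0 yG).
move: yG; rewrite G0 inE => /eqP-> /=.
by rewrite cats0 (cuts_roo0_lea xF x0).
Qed.

Lemma forest_size1 F : forest_size F = 1%N -> exists d, F = [:: PNode d [::]].
Proof.
case/lastP: F => // F [d G]; rewrite forest_size_rcons addnS => -[/eqP].
rewrite addn_eq0 !forest_size_eq0 => /andP[/eqP-> /eqP->]; by exists d.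
Qed.

Lemma bullets_map (s : seq (pforest D)) : (forall F, F \in s -> forest_size F = 1%N) ->
  exists t, s = [seq [:: PNode d [::]] | d <- t].
Proof.
elim: s => [|F s IHs] s1; first by exists [::].
have [|t ->] := IHs; first by move=> G Gs; apply: s1; rewrite in_cons Gs orbT.
by have [d ->] := forest_size1 (s1 F (mem_head _ _)); exists (d :: t).
Qed.

End BulletCuts.

Section Injectivity.
Variables (K : fieldType) (A : lmodType K) (H : dupdend_ops A) (D : choiceType).
Variable p : D -> A.
Hypotheses (H_dd : is_dupdend H) (p_prim : forall d, prim_tot H (p d)).
Implicit Types (F G l r : pforest D).

Local Notation Dprec := (cop_prec H).
Local Notation Dsucc := (cop_succ H).
Local Notation fval := (forest_val H p).

Definition copf (b : bool) (x : A) : tens A A := if b then Dprec x else Dsucc x.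

Lemma copf_linear b : linear (copf b).
Proof.
by case: b; [exact: (cop_prec_linear (dupdend_dend H_dd))
            |exact: (cop_succ_linear (dupdend_dend H_dd))].
Qed.

Lemma copf_forest_val b F : F != [::] -> copf b (fval F) = cut_sum H p b F.
Proof. by move/(cop_forest_val H_dd p_prim) => [? ?]; case: b. Qed.

Section Dual.
Variables (Q : pred (pforest D)) (chi : pforest D -> {linear A -> K^o}).
Hypothesis chiP : forall F G, Q F -> Q G -> chi F (fval G) = (F == G)%:R.

Lemma ev_copf_forest_val b l r F :
  F != [::] -> (forall c, c \in cuts F -> proper_cut c -> Q c.1.1 && Q c.1.2) ->
  Q l -> Q r -> l != [::] -> r != [::] ->
  ev (chi l) (chi r) (copf b (fval F)) = (count_mem (l, r, b) (cuts F))%:R.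
Proof.
move=> F0 cutsQ Ql Qr l0 r0; rewrite copf_forest_val // /cut_sum.
rewrite (linear_sum (ev (chi l) (chi r))) -sum1_count natr_sum.
rewrite big_mkcond [RHS]big_mkcond; apply: eq_big_seq => -[[c1 c2] c3] cF.
rewrite /= !xpair_eqE; case: ifP => [/andP[cp ->]|].
  have /andP[/= Q1 Q2] := cutsQ _ cF cp.
  rewrite /cut_tensor ev_tpure !chiP // -natrM mulnb andbT (eq_sym l) (eq_sym r).
  by case: (_ && _).
rewrite /proper_cut /=; case: (eqVneq c1 l) => [->|] //; case: (eqVneq c2 r) => [->|] //.
by rewrite l0 r0 /= => ->.
Qed.

End Dual.

End Injectivity.

Section Freeness.
Variables (K : fieldType) (A : lmodType K) (H : dupdend_ops A) (D : choiceType).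
Variable p : D -> A.
Hypotheses (H_dd : is_dupdend H) (p_prim : forall d, prim_tot H (p d)).
Hypothesis p_free : forall (s : seq D) (c : D -> K), uniq s ->
  \sum_(d <- s) c d *: p d = 0 -> forall d, d \in s -> c d = 0.
Implicit Types (F G l r : pforest D).

Local Notation fval := (forest_val H p).

Definition small_forest n : pred (pforest D) :=
  fun F => (F != [::]) && (forest_size F <= n)%N.

Lemma small_forest_val_free n (s : seq (pforest D)) (c : pforest D -> K) :
  uniq s -> all (small_forest n) s -> \sum_(F <- s) c F *: fval F = 0 ->
  forall F, F \in s -> c F = 0.
Proof.
elim: n s c => [|n IHn] s c us sn c0 F0 Fs0.
  have /andP[] := allP sn _ Fs0.
  by rewrite leqn0 forest_size_eq0 => /negPf->.
have [chi chiP] := dual_functionals IHn.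
have nz F : F \in s -> F != [::] by move/(allP sn)/andP => [].
have le_n F : F \in s -> (forest_size F <= n.+1)%N by move/(allP sn)/andP => [].
(* If [l] and [r] have at most [n] vertices, the functionals dual to such forests read this sum off
   a coproduct of the linear relation [c0]. Otherwise no forest with at most n + 1 vertices has a
   cut with these non-empty parts. *)
have count0 b l r : l != [::] -> r != [::] ->
    \sum_(F <- s) c F * (count_mem (l, r, b) (cuts F))%:R = 0.
  move=> l0 r0; have [ln|ln] := boolP (small_forest n l && small_forest n r).
    have /andP[Ql Qr] := ln.
    have /(congr1 (fun x => ev (chi l) (chi r) (copf H b x))) := c0.
    pose L := linear_of (linear_comp (linearPw (ev (chi l) (chi r))) (copf_linear H_dd b)).
    rewrite -[LHS]/(L _) -[RHS]/(L 0) linear0 linear_sum => {2}<-.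
    apply: eq_big_seq => F Fs; rewrite linearZ; apply: (congr1 (fun x : K => c F * x)).
    apply/esym/(ev_copf_forest_val H_dd p_prim chiP) => //; first exact: nz.
    move=> x /cuts_size xF /andP[x1 x2]; rewrite /small_forest x1 x2 /=.
    have := le_n F Fs; rewrite -xF.
    move: x1 x2; rewrite -!forest_size_eq0 -!lt0n.
    case: (forest_size _) => // i _; case: (forest_size _) => // j _.
    rewrite addSn addnS !ltnS => le_ij.
    by rewrite (leq_ltn_trans _ le_ij) ?leq_addr // (leq_ltn_trans _ le_ij) ?leq_addl.
  apply: big1_seq => F /andP[_ Fs]; rewrite (count_memPn _) ?mulr0 //.
  apply: contraNN ln => /cuts_size /= lF; rewrite /small_forest l0 r0 /=.
  have := le_n F Fs; rewrite -lF.
  move: l0 r0; rewrite -!forest_size_eq0 -!lt0n.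
  case: (forest_size _) => // i _; case: (forest_size _) => // j _.
  rewrite addSn addnS !ltnS => le_ij.
  by rewrite (leq_ltn_trans _ le_ij) ?leq_addr // (leq_ltn_trans _ le_ij) ?leq_addl.
(* The one-vertex forests have zero coproducts, so they are set aside until the others are
   eliminated; [p_free] then deals with them. *)
pose s2 := [seq F <- s | forest_size F != 1%N].
have s2P F : F \in s2 -> (F \in s) && (forest_size F != 1%N) by rewrite mem_filter andbC.
have cs2 : forall F, F \in s2 -> c F = 0.
  apply: (cut_matrix_inj (s := s2)); first exact: filter_uniq.
    by apply/negP => /s2P/andP[/nz].
  move=> l b dl; have l0 : l != [::] by apply: contraTneq dl => ->.
  have [b0|b0] := eqVneq b [::]; last first.
    apply: etrans (count0 true l b l0 b0); rewrite big_filter [RHS](bigID (fun F => forest_size F != 1%N)) /=.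
    rewrite [X in _ + X]big1_seq ?addr0 // => F; rewrite negbK => /andP[/eqP F1 Fs].
    rewrite (count_memPn _) ?mulr0 //; apply/negP => /cuts_size /=; rewrite F1.
    move: l0 b0; rewrite -!forest_size_eq0.
    by case: (forest_size l) => // i _; case: (forest_size b) => // j _; rewrite addSn addnS.
  case/dot_endedP: dl => a [d El]; rewrite b0.
  (* The row of the full cut is replaced by a proper one, visible in [Dsucc]. This fails only for
     empty [a], where the row meets nothing but a one-vertex forest, absent from [s2]. *)
  transitivity (\sum_(F <- s2) c F * (count_mem (a, [:: PNode d [::]], false) (cuts F))%:R).
    apply: eq_big_seq => F /s2P/andP[/nz F0' _].
    by rewrite cut_mult_roo0 // count_cuts_bullet El.
  have [a0|a0] := eqVneq a [::].
    apply: big1_seq => F /andP[_ /s2P/andP[_ F1]].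
    rewrite count_cuts_bullet a0; case: eqP => [E|_]; last by rewrite mulr0.
    by rewrite E in F1.
  apply: etrans (count0 false a [:: PNode d [::]] a0 isT); rewrite big_filter.
  rewrite [RHS](bigID (fun F => forest_size F != 1%N)) /=.
  rewrite [X in _ + X]big1_seq ?addr0 // => F; rewrite negbK => /andP[/eqP F1 Fs].
  rewrite count_cuts_bullet; case: eqP => [E|_]; last by rewrite mulr0.
  move: F1; rewrite E forest_size_rcons addnS => -[/eqP].
  by rewrite addn0 forest_size_eq0 (negPf a0).
have [F01|F01] := boolP (forest_size F0 != 1%N); first by apply: cs2; rewrite mem_filter F01.
have [|t Et] := @bullets_map _ [seq F <- s | forest_size F == 1%N].
  by move=> F; rewrite mem_filter => /andP[/eqP].
have : F0 \in [seq F <- s | forest_size F == 1%N] by rewrite mem_filter Fs0 -[_ == _]negbK F01.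
rewrite Et => /mapP[d dt ->].
apply: (p_free (s := t) (c := fun d => c [:: PNode d [::]])) => //.
  by apply: (@map_uniq _ _ (fun d => [:: PNode d [::]])); rewrite -Et filter_uniq.
apply: etrans c0; rewrite [RHS](bigID (fun F => forest_size F == 1%N)) /=.
rewrite [X in _ + X]big1_seq ?addr0; last first.
  by move=> F /andP[F1 Fs]; rewrite cs2 ?scale0r // mem_filter F1.
by rewrite -[RHS]big_filter Et big_map.
Qed.

Lemma forest_val_free (s : seq (pforest D)) (c : pforest D -> K) :
  uniq s -> [::] \notin s -> \sum_(F <- s) c F *: fval F = 0 ->
  forall F, F \in s -> c F = 0.
Proof.
move=> us s0; apply: (@small_forest_val_free (\sum_(F <- s) forest_size F)) => //.
apply/allP=> F Fs; apply/andP; split; first by apply: contraTneq Fs => ->.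
by rewrite (big_rem F Fs) /= leq_addr.
Qed.

End Freeness.

Lemma tpurel_linear (K : fieldType) (A B : lmodType K) (b : B) :
  linear (fun a : A => a \ox b).
Proof. by move=> k x y; exact: tpurePl. Qed.

Lemma tpurer_linear (K : fieldType) (A B : lmodType K) (a : A) :
  linear (fun b : B => a \ox b).
Proof. by move=> k x y; exact: tpurePr. Qed.

(** * The span of the values of forests, and tensors over it *)

Section ForestSpan.
Variables (K : fieldType) (A : lmodType K) (H : dupdend_ops A) (D : choiceType).
Variable p : D -> A.
Implicit Types (F G l r : pforest D) (x : A) (t : tens A A).

Local Notation fval := (forest_val H p).

Definition forest_span x := exists2 u : seq (K * pforest D),
  forall y, y \in u -> y.2 != [::] & x = \sum_(y <- u) y.1 *: fval y.2.

Lemma forest_span_val c F : F != [::] -> forest_span (c *: fval F).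
Proof.
move=> F0; exists [:: (c, F)]; last by rewrite big_seq1.
by move=> y; rewrite inE => /eqP->.
Qed.

Lemma forest_span0 : forest_span 0.
Proof. by exists [::]; rewrite ?big_nil. Qed.

Lemma forest_spanD x (y : A) : forest_span x -> forest_span y -> forest_span (x + y).
Proof.
move=> [u u0 ->] [v v0 ->]; exists (u ++ v); last by rewrite big_cat.
by move=> z; rewrite mem_cat => /orP[/u0|/v0].
Qed.

Lemma forest_spanZ c x : forest_span x -> forest_span (c *: x).
Proof.
move=> [u u0 ->]; exists [seq (c * y.1, y.2) | y <- u].
  by move=> _ /mapP[y /u0 ? ->].
by rewrite big_map scaler_sumr; apply: eq_bigr => y _; rewrite scalerA.
Qed.

Lemma forest_span_sum (I : eqType) (s : seq I) (P : pred I) (f : I -> A) :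
  (forall i, i \in s -> P i -> forest_span (f i)) -> forest_span (\sum_(i <- s | P i) f i).
Proof.
move=> fs; rewrite big_seq_cond; apply: big_ind => [||i /andP[? ?]].
- exact: forest_span0.
- exact: forest_spanD.
- exact: fs.
Qed.

Definition tens_span2 t := exists2 s : seq (A * A),
  forall y, y \in s -> forest_span y.1 /\ forest_span y.2 & t = \sum_(y <- s) y.1 \ox y.2.

Lemma tens_span2_tpure x (y : A) : forest_span x -> forest_span y -> tens_span2 (x \ox y).
Proof.
move=> xs ys; exists [:: (x, y)]; last by rewrite big_seq1.
by move=> z; rewrite inE => /eqP->.
Qed.

Lemma tens_span20 : tens_span2 0.
Proof. by exists [::]; rewrite ?big_nil. Qed.

Lemma tens_span2D t t' : tens_span2 t -> tens_span2 t' -> tens_span2 (t + t').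
Proof.
move=> [u u0 ->] [v v0 ->]; exists (u ++ v); last by rewrite big_cat.
by move=> z; rewrite mem_cat => /orP[/u0|/v0].
Qed.

Lemma tens_span2Z c t : tens_span2 t -> tens_span2 (c *: t).
Proof.
move=> [u u0 ->]; exists [seq (c *: y.1, y.2) | y <- u].
  by move=> _ /mapP[y /u0[? ?] ->]; split=> //; exact: forest_spanZ.
rewrite big_map scaler_sumr; apply: eq_bigr => y _ /=.
exact: (esym (linearZ_LR (linear_of (@tpurel_linear K A A y.2)) c y.1)).
Qed.

Lemma tens_span2_sum (I : eqType) (s : seq I) (P : pred I) (f : I -> tens A A) :
  (forall i, i \in s -> P i -> tens_span2 (f i)) -> tens_span2 (\sum_(i <- s | P i) f i).
Proof.
move=> fs; rewrite big_seq_cond; apply: big_ind => [||i /andP[? ?]].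
- exact: tens_span20.
- exact: tens_span2D.
- exact: fs.
Qed.

Lemma evr_span (g : {linear A -> K^o}) t : tens_span2 t -> forest_span (evr g t).
Proof.
move=> [s sP ->]; rewrite (linear_sum (evr g)); apply: forest_span_sum => y /sP[y1 y2] _.
by rewrite /= evr_tpure; exact: forest_spanZ.
Qed.

Lemma evl_span (f : {linear A -> K^o}) t : tens_span2 t -> forest_span (evl f t).
Proof.
move=> [s sP ->]; rewrite (linear_sum (evl f)); apply: forest_span_sum => y /sP[y1 y2] _.
by rewrite /= evl_tpure; exact: forest_spanZ.
Qed.

Variable chi : pforest D -> {linear A -> K^o}.
Hypothesis chiP : forall F G, F != [::] -> G != [::] -> chi F (fval G) = (F == G)%:R.

(** The expansion is stated over every larger list so that finitely many elements can be expanded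
    over a common one. *)
Lemma forest_span_expand x : forest_span x -> exists2 s : seq (pforest D), [::] \notin s &
  forall s', uniq s' -> {subset s <= s'} -> [::] \notin s' ->
    x = \sum_(F <- s') (chi F x : K) *: fval F.
Proof.
move=> [u u0 ->]; exists (map snd u); first by apply/mapP => -[y /u0 y0 y2]; rewrite -y2 eqxx in y0.
move=> s' us us' s0.
under [RHS]eq_bigr do rewrite linear_sum scaler_suml.
rewrite exchange_big /=; apply: eq_big_seq => y yu.
have ys : y.2 \in s' by apply: us'; apply: map_f.
rewrite (bigD1_seq y.2) //= linearZ /= chiP ?u0 // eqxx.
rewrite big1_seq ?addr0 => [|F /andP[Fy Fs]]; first by rewrite -[RHS]/((_ * 1) *: _) mulr1.
rewrite linearZ /= chiP ?u0 // ?(negPf Fy); last by apply: contraNneq s0 => <-.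
by rewrite -[LHS]/((_ * 0) *: _) mulr0 scale0r.
Qed.

Lemma forest_span_eq0 x : forest_span x -> (forall F, F != [::] -> chi F x = 0) -> x = 0.
Proof.
move=> /forest_span_expand[s s0 sE] x0.
rewrite (sE (undup s)) ?undup_uniq ?mem_undup //; last by move=> y; rewrite mem_undup.
by apply: big1_seq => F /andP[_]; rewrite mem_undup => Fs; rewrite x0 ?scale0r //; apply: contraTneq Fs => ->.
Qed.

Lemma forest_span_support x : forest_span x -> exists s : seq (pforest D),
  forall F, F != [::] -> F \notin s -> chi F x = 0.
Proof.
move=> /forest_span_expand[s s0 sE]; exists s => F F0 Fs.
rewrite (sE (undup s)) ?undup_uniq ?mem_undup //; last by move=> y; rewrite mem_undup.
rewrite linear_sum; apply: big1_seq => G /andP[_]; rewrite mem_undup => Gs.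
rewrite linearZ /= chiP //; last by apply: contraTneq Gs => ->.
by case: eqP => [FG|_]; [rewrite FG Gs in Fs|exact: mulr0].
Qed.

(** Expanding all the right legs over a common list of forests gives t = \sum_F evr (chi F) t \ox
    fval F. *)
Lemma tens_span2_eq0r t : tens_span2 t ->
  (forall F, F != [::] -> evr (chi F) t = 0) -> t = 0.
Proof.
move=> [u uP ->] t0.
have [s s0 sE] : exists2 s : seq (pforest D), [::] \notin s & forall y, y \in u ->
    forall s', uniq s' -> {subset s <= s'} -> [::] \notin s' ->
    y.2 = \sum_(F <- s') (chi F y.2 : K) *: fval F.
  elim: u uP {t0} => [|y u IHu] uP; first by exists [::].
  have [|s s0 sE] := IHu; first by move=> z zu; apply: uP; rewrite in_cons zu orbT.
  have [_ /forest_span_expand[r r0 rE]] := uP y (mem_head _ _).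
  exists (r ++ s); first by rewrite mem_cat negb_or r0.
  move=> z; rewrite in_cons => /orP[/eqP->|zu] s' us' ss'; [apply: rE|apply: sE] => // F Fs;
    by apply: ss'; rewrite mem_cat Fs ?orbT.
have E y : y \in u -> y.1 \ox y.2 = \sum_(F <- undup s) evr (chi F) (y.1 \ox y.2) \ox fval F.
  move=> yu; rewrite {1}(sE y yu (undup s)) ?undup_uniq ?mem_undup //; last first.
    by move=> F; rewrite mem_undup.
  rewrite -(linear_ofE (@tpurer_linear K A A y.1)) linear_sum; apply: eq_bigr => F _.
  rewrite evr_tpure linearZ /=.
  exact: (esym (linearZ_LR (linear_of (@tpurel_linear K A A (fval F))) _ y.1)).
rewrite (eq_big_seq _ E) exchange_big /=; apply: big1_seq => F /andP[_].
rewrite mem_undup => Fs.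
pose L := linear_of (@tpurel_linear K A A (fval F)).
have E2 : \sum_(y <- u) evr (chi F) (y.1 \ox y.2) = 0.
  apply: etrans (t0 F _); last by apply: contraTneq Fs => ->.
  by rewrite (linear_sum (evr (chi F))).
by have := linear_sum L u xpredT (fun y => evr (chi F) (y.1 \ox y.2)); rewrite E2 linear0 => <-.
Qed.

End ForestSpan.

(** * Surjectivity: reaching the coproducts of an element within the span *)

Section Cocycles.
Variables (K : fieldType) (A : lmodType K) (H : dupdend_ops A) (D : choiceType).
Variable p : D -> A.
Hypotheses (H_dd : is_dupdend H) (p_prim : forall d, prim_tot H (p d)).
Variable chi : pforest D -> {linear A -> K^o}.
Local Notation fval := (forest_val H p).
Hypothesis chiP : forall F G, F != [::] -> G != [::] -> chi F (fval G) = (F == G)%:R.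
Implicit Types (F G l r : pforest D) (x z : A) (t : tens A A).

Local Notation Dprec := (cop_prec H).
Local Notation Dsucc := (cop_succ H).
Local Notation span := (forest_span H p).
Local Notation span2 := (tens_span2 H p).
Local Notation cval := (fun u : seq (K * pforest D) => \sum_(y <- u) y.1 *: fval y.2).

Lemma copf_span b x : span x -> span2 (copf H b x).
Proof.
move=> [u u0 ->]; rewrite -(linear_ofE (copf_linear H_dd b)) linear_sum.
apply: tens_span2_sum => y yu _; rewrite linearZ; apply: tens_span2Z.
rewrite /= copf_forest_val ?u0 //; apply: tens_span2_sum => c _ /andP[/andP[c1 c2] _].
by apply: tens_span2_tpure; rewrite -[forest_val _ _ _]scale1r; exact: forest_span_val.
Qed.

Lemma ev_copf_val b l r F : F != [::] -> l != [::] -> r != [::] ->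
  ev (chi l) (chi r) (copf H b (fval F)) = (count_mem (l, r, b) (cuts F))%:R.
Proof. by move=> F0 l0 r0; apply: (ev_copf_forest_val H_dd p_prim chiP). Qed.

(* The (l, b)-entry of the multiplicities of cuts, read off an element of A; for
   b = 0 and l = a . bullet_d it comes from the cuts with parts a and bullet_d. *)
Definition theta (lb : pforest D * pforest D) : A -> K^o :=
  if lb.2 != [::] then fun x => ev (chi lb.1) (chi lb.2) (copf H true x)
  else fun x => ev (chi (take (size lb.1).-1 lb.1)) (chi (drop (size lb.1).-1 lb.1))
                 (copf H false x).

(** Among the pairs with dot-ended [l], only those with [l] a single vertex and [b] empty are
    excluded: there [theta] would involve [chi [::]], about which nothing is known. *)
Definition testable (lb : pforest D * pforest D) :=
  dot_ended lb.1 && ((lb.2 != [::]) || (1 < size lb.1)%N).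

Lemma theta_linear lb : linear (theta lb).
Proof.
rewrite /theta; case: ifP => _;
  exact: (linear_comp (linearPw (ev _ _)) (copf_linear H_dd _)).
Qed.

Lemma take_size_rcons (T : Type) (a : seq T) (y : T) : take (size a) (rcons a y) = a.
Proof. by rewrite -cats1 take_size_cat. Qed.

Lemma drop_size_rcons (T : Type) (a : seq T) (y : T) : drop (size a) (rcons a y) = [:: y].
Proof. by rewrite -cats1 drop_size_cat. Qed.

Lemma theta_val lb F : testable lb -> F != [::] -> theta lb (fval F) = (cut_mult lb.1 lb.2 F)%:R.
Proof.
case: lb => l b /andP[/= dl]; rewrite /theta /=; have l0 : l != [::] by apply: contraTneq dl => ->.
case: (eqVneq b [::]) => [-> +|b0 _] F0; last exact: (@ev_copf_val true).
case/dot_endedP: dl => a [d E]; rewrite E size_rcons /= ltnS => a1.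
have a0 : a != [::] by case: (a) a1.
rewrite take_size_rcons drop_size_rcons.
by rewrite -[Dsucc _]/(copf H false _) ev_copf_val // count_cuts_bullet cut_mult_roo0 // rcons_neq_nil.
Qed.

Lemma theta_cval lb (u : seq (K * pforest D)) : testable lb ->
  (forall y, y \in u -> y.2 != [::]) -> theta lb (cval u) = mult_sum u lb.1 lb.2.
Proof.
move=> tlb u0; rewrite -(linear_ofE (theta_linear lb)) linear_sum.
apply: eq_big_seq => y yu; rewrite linearZ.
by apply: (congr1 (fun x : K => y.1 * x)); apply: theta_val => //; exact: u0.
Qed.

(** Each solution of [cut_matrix_solve] has a single non-zero entry, so adjusting one pair leaves
    the others unchanged. *)
Lemma theta_solve x (L : seq (pforest D * pforest D)) : all testable L ->
  exists2 u, span u & forall lb, testable lb ->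
    theta lb u = if lb \in L then theta lb x else 0.
Proof.
elim: L => [_|[l b] L IHL /= /andP[tlb /IHL[u us uP]]].
  exists 0; first exact: forest_span0.
  by move=> lb _; rewrite -(linear_ofE (theta_linear lb)) linear0.
have [lbL|lbL] := boolP ((l, b) \in L).
  exists u => // lb' t'; rewrite uP // in_cons.
  by case: (eqVneq lb' (l, b)) => [->|//]; rewrite lbL.
have /andP[/= dl _] := tlb; have [v v0 vP] := cut_matrix_solve K b dl.
exists ((theta (l, b) x : K) *: cval v + u).
  by apply: forest_spanD => //; apply: forest_spanZ; exists v.
move=> [l' b'] t'; rewrite theta_linear theta_cval // uP // vP; last by case/andP: t'.
rewrite in_cons; case: (eqVneq (l', b') (l, b)) => [->|_] /=.
  by rewrite (negPf lbL) addr0; exact: mulr1.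
by rewrite -[_ *: _]/(_ * 0) mulr0 add0r.
Qed.

Lemma span2_support t : span2 t -> exists s : seq (pforest D * pforest D),
  forall l r, l != [::] -> r != [::] -> (l, r) \notin s -> ev (chi l) (chi r) t = 0.
Proof.
move=> [u uP ->]; elim: u uP => [|y u IHu] uP.
  by exists [::] => *; rewrite big_nil linear0.
have [|s sP] := IHu; first by move=> z zu; apply: uP; rewrite in_cons zu orbT.
have [/(forest_span_support chiP)[s1 s1P] /(forest_span_support chiP)[s2 s2P]] := uP y (mem_head _ _).
exists ([seq (a, b) | a <- s1, b <- s2] ++ s) => l r l0 r0; rewrite mem_cat negb_or => /andP[lr1 lr2].
rewrite big_cons linearD /= sP // addr0 ev_tpure.
have [ls1|ls1] := boolP (l \in s1); last by rewrite s1P // mul0r.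
have [rs2|rs2] := boolP (r \in s2); last by rewrite s2P // mulr0.
by case/negP: lr1; apply/allpairsP; exists (l, r).
Qed.

(** Only finitely many forests occur in the two coproducts of [x]; this finiteness is what makes
    [theta_solve] applicable. *)
Lemma theta_support x : span2 (Dprec x) -> span2 (Dsucc x) ->
  exists2 L, all testable L & forall lb, testable lb -> lb \notin L -> theta lb x = 0.
Proof.
move=> /span2_support[s1 s1P] /span2_support[s2 s2P].
exists [seq lb <- s1 ++ [seq (y.1 ++ y.2, [::]) | y <- s2] | testable lb]; first exact: filter_all.
move=> [l b] tlb; rewrite mem_filter tlb /= mem_cat negb_or => /andP[n1 n2].
have /andP[/= dl] := tlb; have l0 : l != [::] by apply: contraTneq dl => ->.
rewrite /theta /=; have [b0|b0 _] := eqVneq b [::]; last exact: s1P.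
case/dot_endedP: dl => a [d E]; rewrite E size_rcons /= ltnS => a1.
have a0 : a != [::] by case: (a) a1.
rewrite take_size_rcons drop_size_rcons.
apply: s2P => //; apply: contraNN n2 => ad; apply/mapP; exists (a, [:: PNode d [::]]) => //.
by rewrite b0 E cats1.
Qed.

(** On the span, [chi l] is the row [(l, empty)] by [cut_mult_roo0], so the two families of
    conditions cover all the rows of the matrix. *)
Lemma span_theta_eq0 x : span x ->
  (forall l, dot_ended l -> chi l x = 0) ->
  (forall l b, dot_ended l -> b != [::] -> ev (chi l) (chi b) (Dprec x) = 0) ->
  x = 0.
Proof.
move=> sx x0 x1; apply: (forest_span_eq0 chiP sx).
have [s s0 sE] := forest_span_expand chiP sx.
have {sE} xE := sE (undup s) (undup_uniq _) _ _.
have {xE} xE : x = \sum_(F <- undup s) (chi F x : K) *: fval F.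
  by apply: xE => [F|]; rewrite mem_undup.
have sn F : F \in undup s -> F != [::] by rewrite mem_undup => Fs; apply: contraTneq Fs => ->.
move=> F F0; have [Fs|Fs] := boolP (F \in undup s); last first.
  rewrite xE linear_sum; apply: big1_seq => G /andP[_ Gs]; rewrite linearZ /= chiP ?(sn G) //.
  by case: eqP => [E|_]; [rewrite E Gs in Fs|exact: mulr0].
have := @cut_matrix_inj K D (undup s) (fun G => chi G x : K) (undup_uniq _).
rewrite mem_undup => /(_ s0)/(_ _ F Fs); apply.
move=> l b dl; have l0 : l != [::] by apply: contraTneq dl => ->.
have [->|b0] := eqVneq b [::].
  rewrite -[RHS](x0 l dl) {2}xE linear_sum; apply: eq_big_seq => G Gs.
  by rewrite linearZ /= chiP ?(sn G) // cut_mult_roo0 ?(sn G) // eq_sym.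
pose L := linear_of (linear_comp (linearPw (ev (chi l) (chi b))) (copf_linear H_dd true)).
rewrite -[RHS](x1 l b dl b0) -[RHS]/(L x) {2}xE linear_sum; apply: eq_big_seq => G Gs.
rewrite linearZ; apply: (congr1 (fun y : K => chi G x * y)).
by apply/esym/ev_copf_val => //; exact: sn.
Qed.

(* Coassociativity turns the vanishing of theta z into that of every partial
   evaluation of the coproducts of z. *)
Lemma theta_eq0_prim z : span2 (Dprec z) -> span2 (Dsucc z) ->
  (forall lb, testable lb -> theta lb z = 0) -> prim_tot H z.
Proof.
move=> sp ss th0; have dend := dupdend_dend H_dd.
have dn l : dot_ended l -> l != [::] by apply: contraTneq => ->.
have C1 l b : dot_ended l -> b != [::] -> ev (chi l) (chi b) (Dprec z) = 0.
  move=> dl b0; have := th0 (l, b); rewrite /testable dl b0 => /(_ isT).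
  by rewrite /theta /= b0.
have C2 a d : a != [::] -> ev (chi a) (chi [:: PNode d [::]]) (Dsucc z) = 0.
  move=> a0; have := th0 (rcons a (PNode d [::]), [::]).
  rewrite /testable /= dot_ended_rcons size_rcons ltnS lt0n size_eq0 a0 => /(_ isT).
  by rewrite /theta /= size_rcons /= take_size_rcons drop_size_rcons.
have cop0 : cop H 0 = 0 by rewrite -(linear_ofE (cop_linear dend)) linear0.
have succ0 : Dsucc 0 = 0 by rewrite -(linear_ofE (cop_succ_linear dend)) linear0.
(* The contractions [evr (chi b) (Dprec z)] lie in the span. The first axiom turns the entries of
   their own [Dprec] into entries of the coproduct of [evl (chi l) (Dprec z)], which is zero by [C1]
   because [l] is dot-ended. *)
have prec_z : Dprec z = 0.
  apply: (tens_span2_eq0r chiP sp) => b b0.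
  apply: span_theta_eq0 => [|l dl|l b' dl b'0]; first exact: evr_span.
    exact: C1.
  rewrite ev_coprec_coprec // (_ : evl (chi l) (Dprec z) = 0) ?cop0 ?linear0 //.
  apply: (forest_span_eq0 chiP); first exact: evl_span.
  by move=> F F0; rewrite -ev_evl; exact: C1.
split=> //; apply: (tens_span2_eq0r chiP ss) => F F0.
apply: (forest_span_eq0 chiP); first exact: evr_span.
move=> a a0; rewrite -[LHS]/(ev _ _ _) ev_evl (_ : evl (chi a) (Dsucc z) = 0) ?linear0 //.
(* The second axiom and [prec_z] make [Dprec] vanish on this contraction. For l = a' . bullet_d, its
   coefficient on [l] is an entry of its [Dsucc], which the third axiom carries to the contraction
   of [Dsucc z] with bullet_d on the right, zero by [C2]. *)
have wa : span (evl (chi a) (Dsucc z)) by exact: evl_span.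
have Q0 l b : ev (chi l) (chi b) (Dprec (evl (chi a) (Dsucc z))) = 0.
  by rewrite -ev_cosucc_coprec // prec_z !linear0 succ0 linear0.
apply: span_theta_eq0 => // l dl.
case/dot_endedP: (dl) => a' [d E]; have [a'0|a'0] := eqVneq a' [::].
  by rewrite E a'0 -ev_evl; exact: C2.
have -> : chi l (evl (chi a) (Dsucc z)) =
    ev (chi a') (chi [:: PNode d [::]]) (Dsucc (evl (chi a) (Dsucc z))).
  move: wa; set w := evl _ _ => -[u u0 ->].
  pose L := linear_of (linear_comp (linearPw (ev (chi a') (chi [:: PNode d [::]]))) (copf_linear H_dd false)).
  rewrite -[RHS]/(L _) !linear_sum; apply: eq_big_seq => y yu; rewrite !linearZ.
  apply: (congr1 (fun x : K => y.1 * x)); rewrite /= chiP ?u0 ?dn //.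
  by rewrite -[Dsucc _]/(copf H false _) ev_copf_val ?u0 // count_cuts_bullet E eq_sym.
rewrite -ev_cop_cosucc // (_ : evr (chi [:: PNode d [::]]) (Dsucc z) = 0) ?cop0 ?linear0 //.
apply: (forest_span_eq0 chiP); first exact: evr_span.
by move=> G G0; exact: C2.
Qed.

Hypothesis p_span : forall x, prim_tot H x ->
  exists (s : seq D) (c : D -> K), x = \sum_(d <- s) c d *: p d.

Lemma cop_span_span x : span2 (Dprec x) -> span2 (Dsucc x) -> span x.
Proof.
move=> sp ss; have [L tL LP] := theta_support sp ss.
have [u us uP] := theta_solve x tL.
have dend := dupdend_dend H_dd.
have copfB b : copf H b (x - u) = copf H b x + (-1) *: copf H b u.
  by rewrite -(linear_ofE (copf_linear H_dd b)) linearB scaleN1r.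
have spanB b : span2 (copf H b (x - u)).
  rewrite copfB; apply: tens_span2D; first by case: (b).
  by apply: tens_span2Z; exact: copf_span.
have [|s [c zE]] := p_span (x := x - u).
  apply: theta_eq0_prim => [||lb tlb]; [exact: (spanB true)|exact: (spanB false)|].
  rewrite -(linear_ofE (theta_linear lb)) linearB /= uP //.
  by case: ifP => [|/negbT/(LP _ tlb)->]; rewrite ?subrr ?subr0.
rewrite -[x](subrK u) zE; apply: forest_spanD => //.
apply: forest_span_sum => d _ _; rewrite -[p d]/(fval [:: PNode d [::]]).
exact: forest_span_val.
Qed.

Variable Gr : nat -> A -> Prop.
Hypotheses (H_gr : is_graded_dupdend H Gr) (H_conn : forall x, Gr 0%N x -> x = 0).

Lemma graded_span n x : Gr n x -> span x.
Proof.
elim/ltn_ind: n x => n IHn x xn; have [n0|n0] := posnP n.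
  by rewrite (H_conn (x := x)) -?n0 //; exact: forest_span0.
(* Connectedness removes the terms with a leg of degree 0, so both legs of the others have degree
   less than [n]. *)
have deg t : tens_degree Gr n t -> span2 t.
  move=> [s -> sP]; apply: tens_span2_sum => y /sP[i [j [ijn yi yj]]] _.
  have [i0|i0] := posnP i.
    rewrite (H_conn (x := y.1)) -?i0 //.
    rewrite -(linear_ofE (@tpurel_linear K A A y.2)) linear0; exact: tens_span20.
  have [j0|j0] := posnP j.
    rewrite (H_conn (x := y.2)) -?j0 //.
    rewrite -(linear_ofE (@tpurer_linear K A A y.1)) linear0; exact: tens_span20.
  apply: tens_span2_tpure; [apply: (IHn i)|apply: (IHn j)] => //; rewrite -ijn.
    by rewrite -[X in (X < _)%N]addn0 ltn_add2l.
  by rewrite -[X in (X < _)%N]add0n ltn_add2r.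
by apply: cop_span_span; apply: deg; [exact: graded_prec|exact: graded_succ].
Qed.

Lemma all_span x : span x.
Proof.
have [N [c [cG ->]]] := gr_sum (graded_grading H_gr) x.
by apply: forest_span_sum => i _ _; apply: graded_span (cG i).
Qed.

End Cocycles.

(** * The linear map on forests: compatibility with the operations and uniqueness *)

Section LinearExtension.
Variables (K : fieldType) (I : choiceType).

Lemma linext_comp (V W : lmodType K) (L : V -> W) (f : I -> V) (u : {malg K[I]}) :
  linear L -> L (linext f u) = linext (fun i => L (f i)) u.
Proof.
move=> Ll; rewrite /linext -(linear_ofE Ll) linear_sum.
by apply: eq_bigr => i _; rewrite linearZ.
Qed.

Lemma eq_linext (V : lmodType K) (f g : I -> V) (u : {malg K[I]}) :
  f =1 g -> linext f u = linext g u.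
Proof. by move=> fg; apply: eq_bigr => i _; rewrite fg. Qed.

Lemma linear_linext (V : lmodType K) (f : {malg K[I]} -> V) (u : {malg K[I]}) :
  linear f -> f u = linext (fun i => f << i >>) u.
Proof.
move=> fl; rewrite {1}[u]monalgE -[LHS](linear_ofE fl) linear_sum.
apply: eq_bigr => i _; rewrite -[RHS](linearZ_LR (linear_of fl)).
by congr (linear_of fl _); apply/malgP=> k; rewrite mcoeffZ !mcoeffU; case: eqP; rewrite ?mulr1 ?mulr0.
Qed.

Lemma linext_linear (V : lmodType K) (f : I -> V) : linear (@linext K I V f).
Proof. exact: linext_is_linear. Qed.

End LinearExtension.

Section ForestMap.
Variables (K : fieldType) (A : lmodType K) (H : dupdend_ops A) (D : choiceType).
Variable p : D -> A.
Hypotheses (H_dd : is_dupdend H) (p_prim : forall d, prim_tot H (p d)).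
Implicit Types (F G : pforest D) (u v : HpD K D).

Local Notation fval := (forest_val H p).

Definition forest_map u : A := linext (fun F : neforest D => fval (val F)) u.

Lemma forest_map_linear : linear forest_map.
Proof. exact: linext_linear. Qed.

Lemma forest_vecE (F : neforest D) : forest_vec K (val F) = << F >>.
Proof. by rewrite /forest_vec valK. Qed.

Lemma forest_map_vec F : forest_map (forest_vec K F) = fval F.
Proof.
rewrite /forest_vec; case: insubP => [G _ <-|]; last first.
  by rewrite negbK => /eqP->; rewrite /forest_map /linext msupp0 big_nil.
by rewrite /forest_map linextU scale1r.
Qed.

Lemma linext_vec (V : lmodType K) (f : neforest D -> V) (F : neforest D) :
  linext f (forest_vec K (val F)) = f F.
Proof. by rewrite forest_vecE linextU scale1r. Qed.

Lemma bilinext_vec (f : pforest D -> pforest D -> pforest D) F G :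
  F != [::] -> G != [::] ->
  bilinext f (forest_vec K F) (forest_vec K G) = forest_vec K (f F G).
Proof.
move=> F0 G0; rewrite /bilinext.
by rewrite (linext_vec _ (Sub F F0 : neforest D)) (linext_vec _ (Sub G G0 : neforest D)).
Qed.

Lemma forest_map_bilinext (f : pforest D -> pforest D -> pforest D) (m : A -> A -> A) u v :
  bilinear_map m ->
  (forall F G, F != [::] -> G != [::] -> fval (f F G) = m (fval F) (fval G)) ->
  forest_map (bilinext f u v) = m (forest_map u) (forest_map v).
Proof.
move=> [ml mr] fm; rewrite /bilinext (linext_comp _ _ forest_map_linear).
rewrite {2}/forest_map (linext_comp (L := fun x => m x (forest_map v))); last exact: ml.
apply: eq_linext => F; rewrite (linext_comp _ _ forest_map_linear).
rewrite {2}/forest_map (linext_comp (L := m (fval (val F)))); last exact: mr.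
apply: eq_linext => G; rewrite forest_map_vec; exact: fm (valP F) (valP G).
Qed.

Lemma cut_sum_admissible b F : F != [::] ->
  \sum_(V : {set vertex F} | [&& admissible V, Lea V != [::], Roo V != [::]
                               & rleaf_in (lea_vertices V) == b])
    fval (Lea V) \ox fval (Roo V) = cut_sum H p b F.
Proof.
move=> F0; rewrite big_mkcondr.
rewrite (sum_admissible F (fun (l r : pforest D) (c : bool) => if [&& l != [::], r != [::] & c == b] then fval l \ox fval r else 0)).
by rewrite /cut_sum [RHS]big_mkcond; apply: eq_bigr => c _; rewrite /proper_cut -andbA.
Qed.

Lemma tmap_forest_map_sum (I : Type) (s : seq I) (P : pred I) (f g : I -> pforest D) :
  tmap forest_map forest_map (\sum_(i <- s | P i) forest_vec K (f i) \ox forest_vec K (g i)) =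
  \sum_(i <- s | P i) fval (f i) \ox fval (g i).
Proof.
rewrite /tmap (tlift_sum (tpure_bilinear_comp forest_map_linear forest_map_linear)).
by apply: eq_bigr => i _; rewrite !forest_map_vec.
Qed.

Lemma forest_map_prec u :
  tmap forest_map forest_map (cop_prec (HpD_ops K D) u) = cop_prec H (forest_map u).
Proof.
rewrite /= (linext_comp _ _ (tmap_linear forest_map_linear forest_map_linear)).
rewrite /forest_map (linext_comp _ _ (cop_prec_linear (dupdend_dend H_dd))).
apply: eq_linext => F; rewrite -[X in tmap X _]/forest_map -[X in tmap _ X]/forest_map.
rewrite (cop_forest_val H_dd p_prim (valP F)).1 -(cut_sum_admissible true (valP F)).
rewrite /forest_cop_prec tmap_forest_map_sum.
by apply: eq_bigl => V; rewrite eqb_id.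
Qed.

Lemma forest_map_succ u :
  tmap forest_map forest_map (cop_succ (HpD_ops K D) u) = cop_succ H (forest_map u).
Proof.
rewrite /= (linext_comp _ _ (tmap_linear forest_map_linear forest_map_linear)).
rewrite /forest_map (linext_comp _ _ (cop_succ_linear (dupdend_dend H_dd))).
apply: eq_linext => F; rewrite -[X in tmap X _]/forest_map -[X in tmap _ X]/forest_map.
rewrite (cop_forest_val H_dd p_prim (valP F)).2 -(cut_sum_admissible false (valP F)).
rewrite /forest_cop_succ tmap_forest_map_sum.
by apply: eq_bigl => V; rewrite (rleaf_inC _ (valP F)) eqbF_neg.
Qed.

Lemma forest_map_unique (f : HpD K D -> A) : linear f ->
  (forall u v, f (dot (HpD_ops K D) u v) = dot H (f u) (f v)) ->
  (forall u v, f (nwarrow (HpD_ops K D) u v) = nwarrow H (f u) (f v)) ->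
  (forall d, f (bullet K d) = p d) -> f = forest_map.
Proof.
move=> fl fdot fnw fb; apply/funext => u.
rewrite (linear_linext u fl); apply: eq_linext => F; rewrite -forest_vecE.
have dup := dupdend_dup H_dd.
suff fP G : G != [::] -> f (forest_vec K G) = fval G by exact: fP (valP F).
elim/forest_ind: G => // G d L IHG IHL _.
have tP : f (forest_vec K [:: PNode d L]) = tree_val H p (PNode d L).
  rewrite tree_val_PNode; have [->|L0] := eqVneq L [::]; first exact: fb.
  have -> : [:: PNode d L] = graft [:: PNode d [::]] L by [].
  by rewrite -(bilinext_vec (@graft D)) // -[LHS]/(f (nwarrow (HpD_ops K D) _ _)) fnw fb IHL.
rewrite forest_val_rcons; have [->|G0] := eqVneq G [::]; first exact: tP.
by rewrite -cats1 -(bilinext_vec cat) // -[LHS]/(f (dot (HpD_ops K D) _ _)) fdot IHG // tP.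
Qed.

End ForestMap.

Lemma tmapK (K : fieldType) (A B : lmodType K) (f : A -> B) (g : B -> A) :
  linear f -> linear g -> cancel f g -> cancel (tmap f f) (tmap g g).
Proof.
move=> fl gl fK; apply: (@eq_linear_tens _ _ _ _ (fun t => tmap g g (tmap f f t)) id) => // [|a b].
  by apply: linear_comp; apply: tmap_linear.
by rewrite !tmap_tpure // !fK.
Qed.

(** * Degrees, bijectivity and the inverse morphism *)

Section ForestIso.
Variables (K : fieldType) (A : lmodType K) (H : dupdend_ops A) (Gr : nat -> A -> Prop).
Hypotheses (H_gr : is_graded_dupdend H Gr) (H_conn : forall x : A, Gr 0%N x -> x = 0).
Variables (D : choiceType) (deg : D -> nat) (p : D -> A).
Hypotheses (p_basis : is_basis (prim_tot H) p) (p_hom : forall d, Gr (deg d) (p d)).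
Implicit Types (F G : pforest D) (u v : HpD K D).

Local Notation fval := (forest_val H p).
Local Notation phi := (@forest_map K A H D p).

Let H_dd : is_dupdend H := graded_dupdend H_gr.
Let p_prim d : prim_tot H (p d). Proof. by case: p_basis. Qed.

Lemma gr_sum_closed n (I : eqType) (s : seq I) (f : I -> A) :
  (forall i, i \in s -> Gr n (f i)) -> Gr n (\sum_(i <- s) f i).
Proof.
have [g0 gD] := gr_subspace (graded_grading H_gr) n.
move=> fs; rewrite big_seq; apply: big_ind => // x y xn yn.
by rewrite -[x]scale1r; exact: gD.
Qed.

Lemma gr_scale n c x : Gr n x -> Gr n (c *: x).
Proof.
have [g0 gD] := gr_subspace (graded_grading H_gr) n.
by move=> xn; rewrite -[_ *: _]addr0; exact: gD.
Qed.

Lemma forest_val_degree F : F != [::] -> Gr (forest_degree deg F) (fval F).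
Proof.
elim/forest_ind: F => // F d G IHF IHG _.
have tP : Gr (deg d + forest_degree deg G)%N (tree_val H p (PNode d G)).
  rewrite tree_val_PNode; case: eqVneq IHG => [->|_ IHG]; first by rewrite addn0.
  by apply: (graded_nwarrow H_gr) => //; exact: IHG.
have -> : forest_degree deg (rcons F (PNode d G)) =
    (forest_degree deg F + (deg d + forest_degree deg G))%N.
  by rewrite /forest_degree map_rcons -cats1 sumn_cat /= addn0.
rewrite forest_val_rcons; case: eqVneq IHF => [-> _|_ IHF] //.
by apply: (graded_dot H_gr) => //; exact: IHF.
Qed.

Lemma forest_map_degree n u : HpD_degree deg n u -> Gr n (phi u).
Proof.
move=> un; apply: gr_sum_closed => F Fu; apply: gr_scale.
by rewrite -(un F Fu); exact: forest_val_degree (valP F).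
Qed.

Lemma forest_map_free (s : seq (neforest D)) (c : neforest D -> K) : uniq s ->
  \sum_(F <- s) c F *: fval (val F) = 0 -> forall F : neforest D, F \in s -> c F = 0.
Proof.
move=> us s0 F Fs; have [_ _ p_free] := p_basis.
pose c' G := oapp c 0 (insub G : option (neforest D)).
have c'E (G : neforest D) : c' (val G) = c G by rewrite /c' valK.
rewrite -c'E; apply: (forest_val_free H_dd p_prim p_free (s := map val s)).
- by rewrite map_inj_uniq //; exact: val_inj.
- by apply/mapP => -[G _ G0]; have := valP G; rewrite -G0.
- by rewrite big_map -[RHS]s0; apply: eq_bigr => G _; rewrite c'E.
- exact: map_f.
Qed.

Lemma forest_map_inj u v : phi u = phi v -> u = v.
Proof.
move=> uv; apply/malgP => F; apply/eqP; rewrite -subr_eq0 -mcoeffB; apply/eqP.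
have {}uv : phi (u - v) = 0.
  by rewrite -(linear_ofE (forest_map_linear H p)) linearB /= uv subrr.
have [Fu|/mcoeff_outdom//] := boolP (F \in msupp (u - v)).
exact: (@forest_map_free (msupp (u - v)) (fun G : neforest D => (u - v)@_G) (fset_uniq _) uv F Fu).
Qed.

Lemma forest_map_surj x : exists u, phi u = x.
Proof.
have [_ p_span p_free] := p_basis.
have [|chi chiP] := @dual_functionals K A (pforest D) (fun F => F != [::]) fval.
  move=> s c us s0; apply: (forest_val_free H_dd p_prim p_free us).
  by apply/negP => /(allP s0).
have [u u0 ->] := all_span H_dd p_prim chiP p_span H_gr H_conn x.
exists (\sum_(y <- u) y.1 *: forest_vec K y.2).
rewrite -(linear_ofE (forest_map_linear H p)) linear_sum; apply: eq_bigr => y _.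
by rewrite linearZ /= forest_map_vec.
Qed.

(** Sorting the forests of [u] by degree splits [phi u] into homogeneous parts. Directness of the
    grading kills those of degree other than [n], and freeness then kills their coefficients. *)
Lemma forest_map_degree_inv n u : Gr n (phi u) -> HpD_degree deg n u.
Proof.
move=> un F Fu; apply/eqP/negP => /negP Fn.
pose d (G : neforest D) := forest_degree deg (val G).
pose part k := \sum_(G <- msupp u | d G == k) u@_G *: fval (val G).
(* A strict bound for [n] and for the degrees of all the forests in [u]. *)
pose N := (n + \sum_(G <- msupp u) d G).+1.
have dN (G : neforest D) : G \in msupp u -> (d G < N)%N.
  by move=> Gu; rewrite /N ltnS (big_rem G Gu) /= addnCA leq_addr.
have partE : phi u = \sum_(k < N) part k.
  rewrite /part /forest_map /linext.
  under [RHS]eq_bigr do rewrite big_mkcond.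
  rewrite exchange_big /=; apply: eq_big_seq => G Gu.
  rewrite (bigD1 (Ordinal (dN G Gu))) //= eqxx big1 ?addr0 // => k.
  by rewrite -val_eqE /= eq_sym => /negPf->.
have part_gr k : Gr k (part k).
  rewrite /part -big_filter; apply: gr_sum_closed => G.
  rewrite mem_filter => /andP[/eqP <- _]; apply: gr_scale.
  exact: forest_val_degree (valP G).
(* Moving [phi u] into degree [n] produces a homogeneous decomposition of 0, the form that
   [gr_direct] takes. *)
pose c k := part k + (if k == n then (-1) *: phi u else 0).
have c_gr k : Gr k (c k).
  have [g0 gD] := gr_subspace (graded_grading H_gr) k.
  rewrite /c -[part k]scale1r; apply: gD => //.
  by case: eqP => [->|//]; exact: gr_scale.
have c0 : \sum_(k < N) c k = 0.
  rewrite big_split /= -partE (bigD1 (Ordinal (leq_addr _ _ : n < N)%N)) //= eqxx big1.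
    by rewrite addr0 scaleN1r subrr.
  by move=> k; rewrite -val_eqE /= => /negPf->.
have := gr_direct (graded_grading H_gr) c_gr c0 (dN F Fu).
rewrite /c (negPf Fn) addr0 /part -big_filter => dF0.
have := forest_map_free (filter_uniq _ (fset_uniq (msupp u))) dF0 (F := F).
by rewrite mem_filter eqxx Fu => /(_ isT)/eqP; apply/negP; rewrite mcoeff_neq0.
Qed.

Lemma forest_map_morphism :
  is_graded_morphism (HpD_ops K D) (HpD_degree (K := K) deg) H Gr phi.
Proof.
have dup := dupdend_dup H_dd.
split.
- exact: forest_map_linear.
- exact: forest_map_degree.
- move=> u v; apply: forest_map_bilinext; first exact: dot_bilinear dup.
  exact: forest_val_cat.
- move=> u v; apply: forest_map_bilinext; first exact: nwarrow_bilinear dup.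
  exact: forest_val_graft.
- exact: forest_map_prec.
- exact: forest_map_succ.
Qed.

Lemma forest_map_isomorphism :
  is_graded_isomorphism (HpD_ops K D) (HpD_degree (K := K) deg) H Gr phi.
Proof.
have morph := forest_map_morphism; split=> //.
pose psi x := projT1 (cid (forest_map_surj x)).
have psiK x : phi (psi x) = x by rewrite /psi; case: cid.
have phiK u : psi (phi u) = u by apply: forest_map_inj; rewrite psiK.
have psi_lin : linear psi.
  by move=> c x y; apply: forest_map_inj; rewrite (morph_linear morph) !psiK.
(* This transports the coproduct identities of [phi] to [psi]; injectivity of [phi] suffices for the
   other properties except the degree. *)
have phi_tmapK (t : tens (HpD K D) (HpD K D)) : tmap psi psi (tmap phi phi t) = t.
  exact: (tmapK (forest_map_linear H p) psi_lin phiK).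
exists psi; split=> //; split=> //.
- by move=> n x xn; apply: forest_map_degree_inv; rewrite psiK.
- by move=> x y; apply: forest_map_inj; rewrite (morph_dot morph) !psiK.
- by move=> x y; apply: forest_map_inj; rewrite (morph_nwarrow morph) !psiK.
- by move=> x; rewrite -{1}[x]psiK -(morph_prec morph) phi_tmapK.
- by move=> x; rewrite -{1}[x]psiK -(morph_succ morph) phi_tmapK.
Qed.

End ForestIso.

Theorem theorem22 (K : fieldType) (A : lmodType K) (H : dupdend_ops A)
    (G : nat -> A -> Prop)
    (A_graded_dupdend : is_graded_dupdend H G)
    (A_connected : forall x : A, G 0%N x -> x = 0)
    (D : choiceType) (deg : D -> nat) (p : D -> A)
    (p_basis : is_basis (prim_tot H) p)
    (p_homogeneous : forall d : D, G (deg d) (p d)) :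
  exists! phi : HpD K D -> A,
    is_graded_isomorphism (HpD_ops K D) (HpD_degree (K := K) deg) H G phi /\
    forall d : D, phi (bullet K d) = p d.
Proof.
exists (@forest_map K A H D p); split.
  split; first exact: forest_map_isomorphism.
  by move=> d; exact: forest_map_vec.
move=> phi [[morph _] phi_bullet]; apply/esym/(forest_map_unique (graded_dupdend A_graded_dupdend)) => //.
- exact: morph_linear morph.
- exact: morph_dot morph.
- exact: morph_nwarrow morph.
Qed.
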